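(* Fix an o-minimal structure. Let $D \colon \mathbb{R}^p \rightrightarrows \mathbb{R}^p$ be a conservative field for $f\colon\mathbb{R}^p\to\mathbb{R}$, and assume $f$ and $D$ are definable. Then there exist $\rho > 0$, a definable strictly increasing function $\varphi \colon [0, \rho) \to \mathbb{R}_+$ which is $C^1$ on $(0,\rho)$ with $\varphi(0) = 0$, and a continuous definable function $\chi \colon \mathbb{R}_+ \to (0, + \infty)$, such that for all $x \in \mathbb{R}^p$ with $0< |f(x)| \leq \chi(\|x\|)$ and all $v \in D(x)$, $\|v\|\, \varphi'(|f(x)|) \geq 1$.
   Context: A set valued map $D\colon\mathbb{R}^p\rightrightarrows\mathbb{R}^p$ is a conservative field if its graph is closed, its values are nonempty and compact, and for every absolutely continuous loop $\gamma\colon[0,1]\to\mathbb{R}^p$, $\int_0^1 \max_{v\in D(\gamma(t))}\langle\dot\gamma(t),v\rangle\,dt=0$; $D$ is a conservative field for $f$ if moreover $f(x)=f(0)+\int_0^1\max_{v\in D(\gamma(t))}\langle\dot\gamma(t),v\rangle\,dt$ for every absolutely continuous $\gamma$ from $0$ to $x$. Definable means belonging (via graph, for maps) to a fixed o-minimal structure on $(\mathbb{R},+,\cdot)$ (e.g. semialgebraic sets): a family of Boolean algebras of subsets of $\mathbb{R}^p$ containing algebraic sets, stable under products with $\mathbb{R}$ and coordinate projections, whose subsets of $\mathbb{R}$ are exactly finite unions of intervals and points. *)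

(* Defs.v *)
From HB Require Import structures.
From mathcomp Require Import all_boot all_order all_algebra.
From mathcomp Require Import all_classical all_reals all_analysis.
Set Implicit Arguments. Unset Strict Implicit. Unset Printing Implicit Defensive.
Import Order.TTheory GRing.Theory Num.Theory.
Import numFieldNormedType.Exports.
Local Open Scope classical_set_scope.
Local Open Scope ring_scope.

Section Defs.
Variable R : realType.

Definition dotp (p : nat) (a b : 'rV[R]_p) : R := \sum_(i < p) a 0 i * b 0 i.
Definition enorm (p : nat) (a : 'rV[R]_p) : R := Num.sqrt (dotp a a).

Inductive poly_fun (n : nat) : ('rV[R]_n -> R) -> Prop :=
| pf_cst c : poly_fun (fun _ => c)
| pf_coord (i : 'I_n) : poly_fun (fun x => x 0 i)
| pf_add f g : poly_fun f -> poly_fun g -> poly_fun (fun x => f x + g x)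
| pf_mul f g : poly_fun f -> poly_fun g -> poly_fun (fun x => f x * g x).

Definition algebraic_set (n : nat) (A : set 'rV[R]_n) : Prop :=
  exists P, poly_fun P /\ A = [set x | P x = 0].

(* finite union of intervals and points of R (points = degenerate intervals),
   R being identified with 'rV_1 *)
Definition finite_union_itv (A : set 'rV[R]_1) : Prop :=
  exists s : seq (interval R), A = [set x | has (fun I => x 0 0 \in I) s].

Record ominimal := OMinimal {
  om_S : forall n : nat, set 'rV[R]_n -> Prop;
  om_set0 : forall n, @om_S n set0;
  om_setU : forall n A B, @om_S n A -> @om_S n B -> @om_S n (A `|` B);
  om_setC : forall n A, @om_S n A -> @om_S n (~` A);
  om_alg : forall n A, @algebraic_set n A -> @om_S n A;
  om_prodr : forall n A, @om_S n A ->
     @om_S (n + 1) [set row_mx x y | x in A & y in [set: 'rV[R]_1]];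
  om_prodl : forall n A, @om_S n A ->
     @om_S (1 + n) [set row_mx y x | y in [set: 'rV[R]_1] & x in A];
  om_proj : forall n A, @om_S (n + 1) A ->
     @om_S n [set x | exists y : 'rV[R]_1, A (row_mx x y)];
  om_dim1 : forall A, @om_S 1 A <-> finite_union_itv A
}.

Variable O : ominimal.

Definition definable (n : nat) (A : set 'rV[R]_n) : Prop := om_S O A.

Definition definable_fun (p : nat) (f : 'rV[R]_p -> R) : Prop :=
  definable [set row_mx x (\row_(j < 1) f x) | x in [set: 'rV[R]_p]].

Definition definable_setfun (p : nat) (D : 'rV[R]_p -> set 'rV[R]_p) : Prop :=
  definable [set z | exists x v, D x v /\ z = row_mx x v].

Definition definable_fun_on (I : set R) (g : R -> R) : Prop :=
  definable [set row_mx (\row_(j < 1) t) (\row_(j < 1) g t) | t in I].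

End Defs.

Section Conservative.
Variable R : realType.

(* absolute continuity of gamma on [0,1] (finite families of disjoint
   subintervals, listed in increasing order) *)
Definition abs_cont_01 (p : nat) (g : R -> 'rV[R]_p) : Prop :=
  forall eps : R, 0 < eps -> exists2 delta : R, 0 < delta &
    forall (n : nat) (a b : nat -> R),
      (forall i, (i < n)%N -> 0 <= a i /\ a i <= b i /\ b i <= 1) ->
      (forall i j, (i < j < n)%N -> b i <= a j) ->
      \sum_(i < n) (b i - a i) < delta ->
      \sum_(i < n) enorm (g (b i) - g (a i)) < eps.

Definition supp_integrand (p : nat) (D : 'rV[R]_p -> set 'rV[R]_p)
  (g : R -> 'rV[R]_p) (t : R) : R :=
  sup [set dotp (derive1 g t) v | v in D (g t)].

Definition path_integral (p : nat) (D : 'rV[R]_p -> set 'rV[R]_p)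
  (g : R -> 'rV[R]_p) : \bar R :=
  (\int[lebesgue_measure]_(t in `[0%R, 1%R]) (supp_integrand D g t)%:E)%E.

Definition conservative_field (p : nat) (D : 'rV[R]_p -> set 'rV[R]_p) : Prop :=
  closed [set xv : 'rV[R]_p * 'rV[R]_p | D xv.1 xv.2] /\
  (forall x, D x !=set0 /\ compact (D x)) /\
  (forall g : R -> 'rV[R]_p, abs_cont_01 g -> g 0 = g 1 ->
     path_integral D g = 0%E).

Definition conservative_field_for (p : nat) (D : 'rV[R]_p -> set 'rV[R]_p)
  (f : 'rV[R]_p -> R) : Prop :=
  conservative_field D /\
  (forall (x : 'rV[R]_p) (g : R -> 'rV[R]_p), abs_cont_01 g -> g 0 = 0 -> g 1 = x ->
     ((f x - f 0)%:E = path_integral D g)%E).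

End Conservative.

(* Main.v *)
Require Import Defs.
From HB Require Import structures.
From mathcomp Require Import all_boot all_order all_algebra.
From mathcomp Require Import all_classical all_reals all_analysis measurable_realfun.
From mathcomp Require Import ring lra.
Set Implicit Arguments. Unset Strict Implicit. Unset Printing Implicit Defensive.
Import Order.TTheory GRing.Theory Num.Theory.
Import numFieldNormedType.Exports.
Local Open Scope classical_set_scope.
Local Open Scope ring_scope.

(* Choose definably, for each small t > 0, a point x(t) with |f(x(t))| = t and
   v(t) in D(x(t)) minimizing (1 + |x|)^2 |v| up to t^2. The coordinates of
   x(t) are C^1 near 0 by o-minimality, and those of y_i = x_i / (1 + |x_i|)
   are moreover monotone and bounded, so that
   phi0(t) = t + sum_i |y_i(t) - y_i(0+)| is a definable C^1 function tending
   to 0 at 0. Conservativity along the curve forces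
   (1 + |x|)^2 |v| phi0'(|f(x)|) >= 1/8 for all x with |f(x)| small and all
   v in D(x). The weight (1 + |x|)^2 is finally absorbed by taking
   phi = 16 sqrt(phi0) and restricting to phi0(|f(x)|) <= (1 + |x|)^-4. *)

Section Definability.
Variables (R : realType) (O : ominimal R).

(* A formula in n free variables; a bound variable is the last coordinate of a
   longer context, reached through rsubmx. *)
Definition dform n (P : 'rV[R]_n -> Prop) := definable O [set x | P x].

Lemma dform_ext n (P Q : 'rV[R]_n -> Prop) :
  (forall x, P x <-> Q x) -> dform P -> dform Q.
Proof.
by move=> PQ; rewrite /dform (_ : [set x | P x] = [set x | Q x])//;
  apply/seteqP; split=> x /PQ.
Qed.

Lemma dform_not n (P : 'rV[R]_n -> Prop) : dform P -> dform (fun x => ~ P x).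
Proof. exact: om_setC. Qed.

Lemma dform_or n (P Q : 'rV[R]_n -> Prop) :
  dform P -> dform Q -> dform (fun x => P x \/ Q x).
Proof. exact: om_setU. Qed.

Lemma dform_and n (P Q : 'rV[R]_n -> Prop) :
  dform P -> dform Q -> dform (fun x => P x /\ Q x).
Proof.
move=> dP dQ; apply: (@dform_ext _ (fun x => ~ (~ P x \/ ~ Q x))).
  by move=> x; rewrite not_orP !notE.
by apply/dform_not/dform_or; apply: dform_not.
Qed.

Lemma dform_imp n (P Q : 'rV[R]_n -> Prop) :
  dform P -> dform Q -> dform (fun x => P x -> Q x).
Proof.
move=> dP dQ; apply: (@dform_ext _ (fun x => ~ P x \/ Q x)).
  by move=> x; rewrite implyE.
by apply: dform_or => //; apply: dform_not.
Qed.

Lemma dform_true n : dform (fun _ : 'rV[R]_n => True).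
Proof.
apply: (@dform_ext _ (fun _ => ~ False)); first by move=> x; split=> // _ [].
by apply: dform_not; rewrite /dform (_ : [set _ | _] = set0)//; exact: om_set0.
Qed.

Lemma dform_cst n (b : Prop) : dform (fun _ : 'rV[R]_n => b).
Proof.
have [hb|hb] := pselect b.
  by apply: dform_ext (@dform_true n) => x; split.
by apply: dform_ext (dform_not (@dform_true n)) => x; split => [/(_ I)|/hb].
Qed.

Lemma dform_all_seq n (I : eqType) (s : seq I) (P : I -> 'rV[R]_n -> Prop) :
  (forall i, dform (P i)) -> dform (fun x => forall i, i \in s -> P i x).
Proof.
move=> dP; elim: s => [|i s ihs].
  by apply: dform_ext (@dform_true n) => x; split.
apply: dform_ext (dform_and (dP i) ihs) => x; split.
  by move=> [Pi Ps] j; rewrite inE => /predU1P[->//|/Ps].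
by move=> Pis; split=> [|j js]; apply: Pis; rewrite inE ?eqxx ?js ?orbT.
Qed.

Lemma dform_all_fin n (I : finType) (P : I -> 'rV[R]_n -> Prop) :
  (forall i, dform (P i)) -> dform (fun x => forall i, P i x).
Proof.
move=> dP; apply: dform_ext (dform_all_seq (enum I) dP) => x.
by split=> H i; [apply: H; rewrite mem_enum | move=> _].
Qed.

Lemma dform_cast m n (e : m = n) (P : 'rV[R]_m -> Prop) :
  dform P -> dform (fun x : 'rV_n => P (castmx (erefl, esym e) x)).
Proof. by case: _ / e => dP; apply: dform_ext dP => x; rewrite castmx_id. Qed.

Lemma dform_rsub m n (P : 'rV[R]_n -> Prop) :
  dform P -> dform (fun z : 'rV_(m + n) => P (rsubmx z)).
Proof.
move=> dP; elim: m => [|m ih].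
  apply: dform_ext dP => x; rewrite (_ : rsubmx (x : 'rV_(0 + n)) = x)//.
  by apply/rowP => j; rewrite mxE; congr (x _ _); apply/val_inj.
have := om_prodl ih; rewrite -/(definable _ _) => dQ.
apply: (@dform_ext (1 + (m + n)) (fun z => P (rsubmx (rsubmx z)))).
  move=> z; rewrite (_ : rsubmx (rsubmx z) = rsubmx (z : 'rV_(m.+1 + n)))//.
  by apply/rowP => j; rewrite !mxE; congr (z _ _); apply/val_inj.
rewrite /dform (_ : [set x | _] = [set row_mx y x | y in [set: 'rV[R]_1] &
  x in [set z : 'rV_(m + n) | P (rsubmx z)]])//.
apply/seteqP; split=> [z /= Pz|_ [y _ [x /= Px <-]]].
  by exists (lsubmx z) => //; exists (rsubmx z) => //; rewrite hsubmxK.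
by rewrite /= row_mxKr.
Qed.

Lemma dform_proj m n (P : 'rV[R]_(m + n) -> Prop) :
  dform P -> dform (fun x : 'rV_m => exists y : 'rV_n, P (row_mx x y)).
Proof.
elim: n m P => [|n ih] m P.
  move=> dP; have := dform_cast (addn0 m) dP; apply: dform_ext => x; split.
    move=> Px; exists 0; suff -> : row_mx x (0 : 'rV_0) =
      castmx (erefl, esym (addn0 m)) x by [].
    apply/rowP => j; rewrite castmxE mxE/= cast_ord_id.
    case: splitP => [k jk|[]//]; congr (x _ _); exact/val_inj.
  move=> [y]; suff -> : row_mx x y = castmx (erefl, esym (addn0 m)) x by [].
  apply/rowP => j; rewrite castmxE mxE/= cast_ord_id.
  case: splitP => [k jk|[]//]; congr (x _ _); exact/val_inj.
move: P; rewrite -(addn1 n) => P dP.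
have := dform_cast (addnA m n 1) dP => /om_proj.
rewrite -/(definable _ _) -/(@dform _ (fun x => exists y : 'rV[R]_1, _)).
move/ih; apply: dform_ext => x; split.
  move=> [y1 [y2]]; rewrite /= -row_mxA => Py.
  by exists (row_mx y1 y2).
move=> [y]; rewrite -[y]hsubmxK row_mxA => Py.
by exists (lsubmx y), (rsubmx y).
Qed.

Lemma dform_exv m n (P : 'rV[R]_m -> 'rV[R]_n -> Prop) :
  dform (fun z : 'rV_(m + n) => P (lsubmx z) (rsubmx z)) ->
  dform (fun x => exists y, P x y).
Proof.
move/dform_proj; apply: dform_ext => x.
by split=> -[y]; [rewrite row_mxKl row_mxKr|]; exists y => //;
  rewrite row_mxKl row_mxKr.
Qed.

Lemma dform_allv m n (P : 'rV[R]_m -> 'rV[R]_n -> Prop) :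
  dform (fun z : 'rV_(m + n) => P (lsubmx z) (rsubmx z)) ->
  dform (fun x => forall y, P x y).
Proof.
move=> /dform_not; move/(dform_exv (P := fun x y => ~ P x y)) => /dform_not.
by apply: dform_ext => x; split=> [H y|H [y /(_ (H y))]//]; apply: contrapT => Py; apply: H; exists y.
Qed.

Definition pmap m n (u : 'rV[R]_m -> 'rV[R]_n) :=
  forall j, poly_fun (fun x => u x 0 j).

Lemma poly_fun_ext m (e e' : 'rV[R]_m -> R) : e =1 e' -> poly_fun e -> poly_fun e'.
Proof. by move=> /funext ->. Qed.

Lemma pmap_row_mx m n k (u : 'rV[R]_m -> 'rV[R]_n) (v : 'rV[R]_m -> 'rV[R]_k) :
  pmap u -> pmap v -> pmap (fun x => row_mx (u x) (v x)).
Proof.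
move=> pu pv j; case: (splitP j) => i ji.
  apply: poly_fun_ext (pu i) => x; rewrite (_ : j = lshift k i) ?row_mxEl//.
  exact/val_inj.
apply: poly_fun_ext (pv i) => x; rewrite (_ : j = rshift n i) ?row_mxEr//.
exact/val_inj.
Qed.

Lemma poly_fun_comp m n (u : 'rV[R]_m -> 'rV[R]_n) e :
  pmap u -> poly_fun e -> poly_fun (fun x => e (u x)).
Proof.
move=> pu; elim=> [c|i|f g _ pf _ pg|f g _ pf _ pg].
- exact: pf_cst.
- exact: pu.
- exact: pf_add.
- exact: pf_mul.
Qed.

Lemma poly_fun_opp m (e : 'rV[R]_m -> R) :
  poly_fun e -> poly_fun (fun x => - e x).
Proof.
by move=> pe; under eq_fun do rewrite -mulN1r; apply: pf_mul => //; exact: pf_cst.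
Qed.

Lemma pmap_lsub m n : pmap (@lsubmx R 1 m n).
Proof. by move=> j; under eq_fun do rewrite mxE; exact: pf_coord. Qed.

Lemma pmap_rsub m n : pmap (@rsubmx R 1 m n).
Proof. by move=> j; under eq_fun do rewrite mxE; exact: pf_coord. Qed.

Lemma dform_poly_eq0 m (e : 'rV[R]_m -> R) : poly_fun e -> dform (fun x => e x = 0).
Proof. by move=> pe; apply: om_alg; exists e. Qed.

Lemma dform_eq_pmap m n (u v : 'rV[R]_m -> 'rV[R]_n) :
  pmap u -> pmap v -> dform (fun x => u x = v x).
Proof.
move=> pu pv; apply: (@dform_ext _ (fun x => forall j, u x 0 j - v x 0 j = 0)).
  move=> x; split=> [H|->]; last by move=> j; rewrite subrr.
  by apply/rowP => j; apply/eqP; rewrite -subr_eq0 H.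
apply: dform_all_fin => j; apply: dform_poly_eq0.
by apply: pf_add => //; apply: poly_fun_opp.
Qed.

Lemma dform_pmap m n (u : 'rV[R]_m -> 'rV[R]_n) (P : 'rV[R]_n -> Prop) :
  pmap u -> dform P -> dform (fun x => P (u x)).
Proof.
move=> pu dP; apply: (@dform_ext _ (fun x => exists y, y = u x /\ P y)).
  by move=> x; split=> [[y [->]]|Pu] //; exists (u x).
apply: dform_exv; apply: dform_and; last exact: dform_rsub.
apply: dform_eq_pmap; first exact: pmap_rsub.
by move=> j; apply: (poly_fun_comp (@pmap_lsub m n) (pu j)).
Qed.

Definition dterm n (e : 'rV[R]_n -> R) :=
  dform (fun z : 'rV_(n + 1) => rsubmx z 0 0 = e (lsubmx z)).

Definition dmap m n (u : 'rV[R]_m -> 'rV[R]_n) :=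
  forall j, dterm (fun x => u x 0 j).

Lemma dterm_ext m (e e' : 'rV[R]_m -> R) : e =1 e' -> dterm e -> dterm e'.
Proof. by move=> /funext ->. Qed.

Lemma dterm_poly m (e : 'rV[R]_m -> R) : poly_fun e -> dterm e.
Proof.
move=> pe; apply: (@dform_ext _ (fun z => rsubmx z 0 0 - e (lsubmx z) = 0)).
  by move=> z; split=> [/eqP|->]; [rewrite subr_eq0 => /eqP|rewrite subrr].
apply: dform_poly_eq0; apply: pf_add; first exact: pmap_rsub.
by apply/poly_fun_opp/poly_fun_comp => //; exact: pmap_lsub.
Qed.

Lemma dterm_comp_pmap m n (u : 'rV[R]_m -> 'rV[R]_n) e :
  pmap u -> dterm e -> dterm (fun x => e (u x)).
Proof.
move=> pu de; pose U (z : 'rV[R]_(m + 1)) := row_mx (u (lsubmx z)) (rsubmx z).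
have pU : pmap U.
  apply: pmap_row_mx; last exact: pmap_rsub.
  by move=> k; apply: (poly_fun_comp (@pmap_lsub m 1) (pu k)).
have := dform_pmap pU de; apply: dform_ext => z.
by rewrite /U row_mxKl row_mxKr.
Qed.

Lemma dform_comp m n (u : 'rV[R]_m -> 'rV[R]_n) (P : 'rV[R]_n -> Prop) :
  dmap u -> dform P -> dform (fun x => P (u x)).
Proof.
move=> du dP; apply: (@dform_ext _ (fun x => exists y : 'rV_n,
    (forall j, y 0 j = u x 0 j) /\ P y)).
  move=> x; split=> [[y [yu Py]]|Pu]; last by exists (u x).
  by rewrite (_ : u x = y)//; apply/rowP.
apply: dform_exv; apply: dform_and; last exact: dform_rsub.
apply: dform_all_fin => j.
have pF : pmap (fun z : 'rV[R]_(m + n) => row_mx (lsubmx z) (\row_(i < 1) rsubmx z 0 j)).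
  apply: pmap_row_mx; first exact: pmap_lsub.
  by move=> k; apply: poly_fun_ext (@pmap_rsub m n j) => x; rewrite mxE.
have := dform_pmap pF (du j); apply: dform_ext => z.
by rewrite row_mxKl row_mxKr mxE.
Qed.

Lemma dmap_row_mx m n k (u : 'rV[R]_m -> 'rV[R]_n) (v : 'rV[R]_m -> 'rV[R]_k) :
  dmap u -> dmap v -> dmap (fun x => row_mx (u x) (v x)).
Proof.
move=> du dv j; case: (splitP j) => i ji.
  apply: dterm_ext (du i) => x; rewrite (_ : j = lshift k i) ?row_mxEl//.
  exact/val_inj.
apply: dterm_ext (dv i) => x; rewrite (_ : j = rshift n i) ?row_mxEr//.
exact/val_inj.
Qed.

Lemma dmap_id m : dmap (fun x : 'rV[R]_m => x).
Proof. by move=> j; apply: dterm_poly; exact: pf_coord. Qed.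

Lemma dmap_lsub m n k (u : 'rV[R]_m -> 'rV[R]_(n + k)) :
  dmap u -> dmap (fun x => lsubmx (u x)).
Proof. by move=> du j; apply: dterm_ext (du (lshift k j)) => x; rewrite mxE. Qed.

Lemma dmap_rsub m n k (u : 'rV[R]_m -> 'rV[R]_(n + k)) :
  dmap u -> dmap (fun x => rsubmx (u x)).
Proof. by move=> du j; apply: dterm_ext (du (rshift n j)) => x; rewrite mxE. Qed.

Lemma dterm_coord m n (u : 'rV[R]_m -> 'rV[R]_n) j :
  dmap u -> dterm (fun x => u x 0 j).
Proof. exact. Qed.

Lemma dmap_row m n (F : 'I_n -> 'rV[R]_m -> R) :
  (forall j, dterm (F j)) -> dmap (fun x => \row_j F j x).
Proof. by move=> dF j; apply: dterm_ext (dF j) => x; rewrite mxE. Qed.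

Lemma dterm_comp m n (u : 'rV[R]_m -> 'rV[R]_n) e :
  dmap u -> dterm e -> dterm (fun x => e (u x)).
Proof.
move=> du de.
have dU : dmap (fun z : 'rV[R]_(m + 1) => row_mx (u (lsubmx z)) (rsubmx z)).
  apply: dmap_row_mx; last exact/dmap_rsub/dmap_id.
  by move=> j; apply: (dterm_comp_pmap (@pmap_lsub m 1) (du j)).
have := dform_comp dU de; apply: dform_ext => z.
by rewrite row_mxKl row_mxKr.
Qed.

Lemma dform_ex m (P : 'rV[R]_m -> R -> Prop) :
  dform (fun z : 'rV_(m + 1) => P (lsubmx z) (rsubmx z 0 0)) ->
  dform (fun x => exists y, P x y).
Proof.
move=> /(dform_exv (P := fun x (y : 'rV_1) => P x (y 0 0))).
apply: dform_ext => x; split=> -[y Py]; first by exists (y 0 0).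
by exists (\row__ y); rewrite mxE.
Qed.

Lemma dform_all m (P : 'rV[R]_m -> R -> Prop) :
  dform (fun z : 'rV_(m + 1) => P (lsubmx z) (rsubmx z 0 0)) ->
  dform (fun x => forall y, P x y).
Proof.
move=> /(dform_allv (P := fun x (y : 'rV_1) => P x (y 0 0))).
apply: dform_ext => x; split=> H y; last exact: H.
by have := H (\row__ y); rewrite mxE.
Qed.

Lemma dform_pair m (e1 e2 : 'rV[R]_m -> R) (P : 'rV[R]_2 -> Prop) :
  dterm e1 -> dterm e2 -> dform P ->
  dform (fun x => P (row_mx (\row_(j < 1) e1 x) (\row_(j < 1) e2 x) : 'rV_(1 + 1))).
Proof.
move=> d1 d2; apply: (dform_comp (u := fun x =>
  row_mx (\row_(j < 1) e1 x) (\row_(j < 1) e2 x))).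
by apply: dmap_row_mx; apply: dmap_row.
Qed.

Lemma dform_eq m (e1 e2 : 'rV[R]_m -> R) :
  dterm e1 -> dterm e2 -> dform (fun x => e1 x = e2 x).
Proof.
move=> d1 d2.
have : @dform (1 + 1) (fun z => lsubmx z = rsubmx z).
  by apply: dform_eq_pmap; [exact: pmap_lsub|exact: pmap_rsub].
move=> /(dform_pair d1 d2); apply: dform_ext => x.
by rewrite row_mxKl row_mxKr; split=> [/rowP/(_ 0)|->]; rewrite ?mxE.
Qed.

Lemma dterm_pair_poly m (e1 e2 : 'rV[R]_m -> R) (q : 'rV[R]_(1 + 1) -> R) :
  dterm e1 -> dterm e2 -> poly_fun q ->
  dterm (fun x => q (row_mx (\row_(j < 1) e1 x) (\row_(j < 1) e2 x))).
Proof.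
move=> d1 d2 pq; apply: dterm_comp (dterm_poly pq).
by apply: dmap_row_mx; apply: dmap_row.
Qed.

Lemma dterm_cst m (c : R) : dterm (fun _ : 'rV[R]_m => c).
Proof. by apply: dterm_poly; exact: pf_cst. Qed.

Lemma dterm_add m (e1 e2 : 'rV[R]_m -> R) :
  dterm e1 -> dterm e2 -> dterm (fun x => e1 x + e2 x).
Proof.
move=> d1 d2; have : poly_fun (fun z : 'rV[R]_(1 + 1) => lsubmx z 0 0 + rsubmx z 0 0).
  by apply: pf_add; [exact: pmap_lsub|exact: pmap_rsub].
move=> /(dterm_pair_poly d1 d2); apply: dterm_ext => x.
by rewrite row_mxKl row_mxKr !mxE.
Qed.

Lemma dterm_mul m (e1 e2 : 'rV[R]_m -> R) :
  dterm e1 -> dterm e2 -> dterm (fun x => e1 x * e2 x).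
Proof.
move=> d1 d2; have : poly_fun (fun z : 'rV[R]_(1 + 1) => lsubmx z 0 0 * rsubmx z 0 0).
  by apply: pf_mul; [exact: pmap_lsub|exact: pmap_rsub].
move=> /(dterm_pair_poly d1 d2); apply: dterm_ext => x.
by rewrite row_mxKl row_mxKr !mxE.
Qed.

Lemma dterm_opp m (e : 'rV[R]_m -> R) : dterm e -> dterm (fun x => - e x).
Proof.
move=> d; have := dterm_mul (dterm_cst m (- 1)) d.
by apply: dterm_ext => x; rewrite mulN1r.
Qed.

Lemma dterm_exp m (e : 'rV[R]_m -> R) k : dterm e -> dterm (fun x => e x ^+ k).
Proof.
move=> d; elim: k => [|k ih]; first exact: dterm_cst.
by have := dterm_mul d ih; apply: dterm_ext => x; rewrite exprS.
Qed.

Lemma dterm_sum m (I : Type) (s : seq I) (F : I -> 'rV[R]_m -> R) :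
  (forall i, dterm (F i)) -> dterm (fun x => \sum_(i <- s) F i x).
Proof.
move=> dF; elim: s => [|i s ihs].
  by apply: dterm_ext (dterm_cst m 0) => x; rewrite big_nil.
by apply: dterm_ext (dterm_add (dF i) ihs) => x; rewrite big_cons.
Qed.

Lemma dform_lt m (e1 e2 : 'rV[R]_m -> R) :
  dterm e1 -> dterm e2 -> dform (fun x => e1 x < e2 x).
Proof.
move=> d1 d2; apply: (@dform_ext _ (fun x => exists u, u ^+ 2 * (e2 x - e1 x) = 1)).
  move=> x; split=> [[u e]|lt12].
    rewrite -subr_gt0; have u0 : 0 <= u ^+ 2 by rewrite sqr_ge0.
    rewrite ltNge; apply/negP => le0.
    have := mulr_ge0_le0 u0 le0; rewrite e; lra.
  exists (Num.sqrt (e2 x - e1 x)^-1); rewrite sqr_sqrtr ?mulVf//.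
    by rewrite subr_eq0 gt_eqF.
  by rewrite invr_ge0 subr_ge0 ltW.
apply: dform_ex; apply: dform_eq (dterm_cst _ _).
apply: dterm_mul; first exact/dterm_exp/dmap_rsub/dmap_id.
apply: dterm_add; last apply: dterm_opp.
  by apply: dterm_comp_pmap d2; exact: pmap_lsub.
by apply: dterm_comp_pmap d1; exact: pmap_lsub.
Qed.

Lemma dform_le m (e1 e2 : 'rV[R]_m -> R) :
  dterm e1 -> dterm e2 -> dform (fun x => e1 x <= e2 x).
Proof.
move=> d1 d2; apply: dform_ext (dform_not (dform_lt d2 d1)) => x.
by split=> [/negP|]; [rewrite -leNgt|move=> h; apply/negP; rewrite -leNgt].
Qed.

Lemma dterm_graph m (e : 'rV[R]_m -> R) (P : 'rV[R]_m -> R -> Prop) :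
  (forall x y, P x y <-> y = e x) ->
  dform (fun z : 'rV_(m + 1) => P (lsubmx z) (rsubmx z 0 0)) -> dterm e.
Proof. by move=> Pe; apply: dform_ext => z; rewrite Pe. Qed.

Lemma dterm_weaken m k (e : 'rV[R]_m -> R) :
  dterm e -> dterm (fun z : 'rV_(m + k) => e (lsubmx z)).
Proof. by move=> d; apply: dterm_comp_pmap d; exact: pmap_lsub. Qed.

Lemma dform_weaken m k (P : 'rV[R]_m -> Prop) :
  dform P -> dform (fun z : 'rV_(m + k) => P (lsubmx z)).
Proof. by move=> d; apply: dform_pmap d; exact: pmap_lsub. Qed.

Lemma dterm_var m : dterm (fun z : 'rV[R]_(m + 1) => rsubmx z 0 0).
Proof. exact/dmap_rsub/dmap_id. Qed.

Lemma dterm_if m (P : 'rV[R]_m -> Prop) (e1 e2 : 'rV[R]_m -> R) :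
  dform P -> dterm e1 -> dterm e2 -> dterm (fun x => if `[<P x>] then e1 x else e2 x).
Proof.
move=> dP d1 d2; apply: (@dterm_graph _ _ (fun x y => (P x /\ y = e1 x) \/
   (~ P x /\ y = e2 x))).
  move=> x y; case: asboolP => Px; split => [[[]|[]]|] //; first by left.
  by right.
apply: dform_or; apply: dform_and.
- exact: dform_weaken.
- by apply: dform_eq; [exact: dterm_var|exact: dterm_weaken].
- exact/dform_not/dform_weaken.
- by apply: dform_eq; [exact: dterm_var|exact: dterm_weaken].
Qed.

Lemma dterm_inv m (e : 'rV[R]_m -> R) : dterm e -> dterm (fun x => (e x)^-1).
Proof.
move=> d; apply: (@dterm_graph _ _ (fun x y => (e x = 0 /\ y = 0) \/
   y * e x = 1)).
  move=> x y; have [->|e0] := eqVneq (e x) 0.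
    rewrite invr0 mulr0; split => [[[]//|/eqP]|->]; last by left.
    by rewrite eq_sym oner_eq0.
  split=> [[[/eqP]|h]|->]; first by rewrite (negPf e0).
    by apply: (mulIf e0); rewrite h mulVf.
  by right; rewrite mulVf.
apply: dform_or.
  apply: dform_and; apply: dform_eq.
  - exact: dterm_weaken.
  - exact: dterm_cst.
  - exact: dterm_var.
  - exact: dterm_cst.
apply: dform_eq; last exact: dterm_cst.
by apply: dterm_mul; [exact: dterm_var|exact: dterm_weaken].
Qed.

Lemma dterm_abs m (e : 'rV[R]_m -> R) : dterm e -> dterm (fun x => `|e x|).
Proof.
move=> d; apply: dterm_ext (dterm_if (dform_le (dterm_cst m 0) d) d (dterm_opp d)) => x.
by case: asboolP => [/ger0_norm->//|/negP]; rewrite -ltNge => /ltr0_norm ->.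
Qed.

Lemma dterm_sqrt m (e : 'rV[R]_m -> R) : dterm e -> dterm (fun x => Num.sqrt (e x)).
Proof.
move=> d; apply: (@dterm_graph _ _ (fun x y => (e x <= 0 /\ y = 0) \/
   (0 < e x /\ 0 <= y /\ y ^+ 2 = e x))).
  move=> x y; have [e0|e0] := leP (e x) 0.
    rewrite ler0_sqrtr//; split => [[[]//|[]]//|->]; by left.
  split=> [[[]//|[_ [y0 <-]]]|->]; first by rewrite sqrtr_sqr ger0_norm.
  by right; rewrite sqrtr_ge0 sqr_sqrtr// ltW.
apply: dform_or; apply: dform_and.
- by apply: dform_le; [exact: dterm_weaken|exact: dterm_cst].
- by apply: dform_eq; [exact: dterm_var|exact: dterm_cst].
- by apply: dform_lt; [exact: dterm_cst|exact: dterm_weaken].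
apply: dform_and.
- by apply: dform_le; [exact: dterm_cst|exact: dterm_var].
- by apply: dform_eq; [exact/dterm_exp/dterm_var|exact: dterm_weaken].
Qed.

Lemma dterm_dotp m n (u v : 'rV[R]_m -> 'rV[R]_n) :
  dmap u -> dmap v -> dterm (fun x => dotp (u x) (v x)).
Proof. by move=> du dv; apply: dterm_sum => i; apply: dterm_mul. Qed.

Lemma dterm_enorm m n (u : 'rV[R]_m -> 'rV[R]_n) :
  dmap u -> dterm (fun x => enorm (u x)).
Proof. by move=> du; apply/dterm_sqrt/dterm_dotp. Qed.

Definition dfun (g : R -> R) := dterm (fun x : 'rV[R]_1 => g (x 0 0)).

Lemma dterm_dfun m (g : R -> R) (e : 'rV[R]_m -> R) :
  dfun g -> dterm e -> dterm (fun x => g (e x)).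
Proof.
move=> dg de; have := dterm_comp (dmap_row (F := fun _ : 'I_1 => e) (fun=> de)) dg.
by apply: dterm_ext => x; rewrite mxE.
Qed.

Lemma dterm_definable_fun m p (f : 'rV[R]_p -> R) (u : 'rV[R]_m -> 'rV[R]_p) :
  definable_fun O f -> dmap u -> dterm (fun x => f (u x)).
Proof.
move=> df du; apply: dterm_comp => //; apply: dform_ext df => z; split.
  by move=> [x _ <-]; rewrite row_mxKl row_mxKr mxE.
move=> h; exists (lsubmx z) => //; rewrite -[RHS]hsubmxK; congr row_mx.
by apply/rowP => j; rewrite (ord1 j) h mxE.
Qed.

Lemma dform_definable_setfun m p (D : 'rV[R]_p -> set 'rV[R]_p)
    (u v : 'rV[R]_m -> 'rV[R]_p) :
  definable_setfun O D -> dmap u -> dmap v -> dform (fun x => D (u x) (v x)).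
Proof.
move=> dD du dv; have := dform_comp (dmap_row_mx du dv) dD.
apply: dform_ext => x /=; split=> [[a [b [Dab]]]|Dx].
  by move=> /eq_row_mx[-> ->].
by exists (u x), (v x).
Qed.

End Definability.

Section DefinableChoice.
Variables (R : realType) (O : ominimal R).
Local Notation dform := (dform O).
Local Notation dterm := (dterm O).
Local Notation dmap := (dmap O).

Lemma dform_app2 m n k (P : 'rV[R]_n -> 'rV[R]_k -> Prop)
    (u : 'rV[R]_m -> 'rV[R]_n) (v : 'rV[R]_m -> 'rV[R]_k) :
  dform (fun z : 'rV_(n + k) => P (lsubmx z) (rsubmx z)) ->
  dmap u -> dmap v -> dform (fun x => P (u x) (v x)).
Proof.
move=> dP du dv; apply: dform_ext (dform_comp (dmap_row_mx du dv) dP) => x.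
by rewrite row_mxKl row_mxKr.
Qed.

Lemma dform_app1 m n (P : 'rV[R]_n -> R -> Prop)
    (u : 'rV[R]_m -> 'rV[R]_n) (e : 'rV[R]_m -> R) :
  dform (fun z : 'rV_(n + 1) => P (lsubmx z) (rsubmx z 0 0)) ->
  dmap u -> dterm e -> dform (fun x => P (u x) (e x)).
Proof.
move=> dP du de; have := dform_app2 (P := fun x (y : 'rV_1) => P x (y 0 0)) dP du
  (dmap_row (fun _ : 'I_1 => de)).
by apply: dform_ext => x; rewrite mxE.
Qed.

Definition dpred (P : R -> Prop) := dform (fun x : 'rV_1 => P (x 0 0)).

Lemma dpred_app m (P : R -> Prop) (e : 'rV[R]_m -> R) :
  dpred P -> dterm e -> dform (fun x => P (e x)).
Proof.
move=> dP de; apply: dform_ext (dform_comp (dmap_row (fun _ : 'I_1 => de)) dP) => x.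
by rewrite mxE.
Qed.

Lemma dmap_comp m n k (u : 'rV[R]_m -> 'rV[R]_n) (v : 'rV[R]_n -> 'rV[R]_k) :
  dmap u -> dmap v -> dmap (fun x => v (u x)).
Proof. by move=> du dv j; apply: (dterm_comp du (dv j)). Qed.

Lemma dmap_lsubmx m n : dmap (@lsubmx R 1 m n).
Proof. exact/dmap_lsub/dmap_id. Qed.

Lemma dmap_rsubmx m n : dmap (@rsubmx R 1 m n).
Proof. exact/dmap_rsub/dmap_id. Qed.

End DefinableChoice.

Ltac dstep :=
  lazymatch goal with
  | |- @dpred _ _ _ => rewrite /dpred
  | |- @dfun _ _ _ => rewrite /dfun
  | |- @dform _ _ _ (fun _ => ?b) => exact: dform_cst
  | |- @dform _ _ _ (fun x => ~ _) => apply: dform_not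
  | |- @dform _ _ _ (fun x => _ /\ _) => apply: dform_and
  | |- @dform _ _ _ (fun x => _ \/ _) => apply: dform_or
  | |- @dform _ _ _ (fun x => exists _ : 'rV_ _, _) => apply: dform_exv
  | |- @dform _ _ _ (fun x => exists _, _) => apply: dform_ex
  | |- @dform _ _ _ (fun x => is_true (_ < _)) => apply: dform_lt
  | |- @dform _ _ _ (fun x => is_true (_ <= _)) => apply: dform_le
  | |- @dform _ _ _ (fun x => _ = _) => apply: dform_eq
  | H : definable_setfun _ ?D |- @dform _ _ _ (fun x => ?D _ _) =>
      apply: (dform_definable_setfun H)
  | H : dpred _ ?P |- @dform _ _ _ (fun x => ?P _) => apply: (dpred_app H)
  | H : @dform _ _ _ (fun z => ?P _ _) |- @dform _ _ _ (fun x => ?P _ _) =>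
      first [apply: (dform_app1 H) | apply: (dform_app2 H)]
  | |- @dform _ _ _ _ => first [apply: dform_imp | apply: dform_all | apply: dform_allv]
  | |- @dterm _ _ _ (fun _ => ?b) => exact: dterm_cst
  | |- @dterm _ _ _ (fun x => if _ then _ else _) => apply: dterm_if
  | |- @dterm _ _ _ (fun x => _ + _) => apply: dterm_add
  | |- @dterm _ _ _ (fun x => - _) => apply: dterm_opp
  | |- @dterm _ _ _ (fun x => _ * _) => apply: dterm_mul
  | |- @dterm _ _ _ (fun x => _^-1) => apply: dterm_inv
  | |- @dterm _ _ _ (fun x => _ ^+ _) => apply: dterm_exp
  | |- @dterm _ _ _ (fun x => `|_|) => apply: dterm_abs
  | |- @dterm _ _ _ (fun x => Num.sqrt _) => apply: dterm_sqrt
  | |- @dterm _ _ _ (fun x => enorm _) => apply: dterm_enorm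
  | |- @dterm _ _ _ (fun x => dotp _ _) => apply: dterm_dotp
  | |- @dterm _ _ _ (fun x => \sum_(i <- _) _) => apply: dterm_sum => ?
  | H : dfun _ ?g |- @dterm _ _ _ (fun x => ?g _) => apply: (dterm_dfun H)
  | H : forall i, dfun _ (?g i) |- @dterm _ _ _ (fun x => ?g _ _) =>
      apply: (dterm_dfun (H _))
  | H : definable_fun _ ?f |- @dterm _ _ _ (fun x => ?f _) =>
      apply: (dterm_definable_fun H)
  | H : dterm _ ?e |- @dterm _ _ _ (fun x => ?e _) => apply: (dterm_comp _ H)
  | H : dterm _ ?e |- @dterm _ _ _ ?e => exact: H
  | |- @dterm _ _ _ (fun x => fun_of_matrix _ _ _) => apply: dterm_coord
  | |- @dmap _ _ _ _ (fun x => x) => exact: dmap_id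
  | |- @dmap _ _ _ _ (@lsubmx _ _ _ _) => exact: dmap_lsubmx
  | |- @dmap _ _ _ _ (@rsubmx _ _ _ _) => exact: dmap_rsubmx
  | |- @dmap _ _ _ _ (fun x => row_mx _ _) => apply: dmap_row_mx
  | |- @dmap _ _ _ _ (fun x => lsubmx _) => apply: dmap_lsub
  | |- @dmap _ _ _ _ (fun x => rsubmx _) => apply: dmap_rsub
  | |- @dmap _ _ _ _ (fun x => \row_j _) => apply: dmap_row => ?
  | H : @dmap _ _ _ _ ?u |- @dmap _ _ _ _ (fun x => ?u _) => apply: (dmap_comp _ H)
  | H : @dmap _ _ _ _ ?u |- @dmap _ _ _ _ ?u => exact: H
  | |- @dmap _ _ _ _ (fun _ => _) => move=> ?; exact: dterm_cst
  end.

Ltac dfn := do ?dstep.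

Section DefinableChoiceTheory.
Variables (R : realType) (O : ominimal R).
Local Notation dform := (dform O).
Local Notation dterm := (dterm O).
Local Notation dmap := (dmap O).
Local Notation dfun := (dfun O).
Local Notation dpred := (dpred O).

Lemma near_rightP (a : R) P :
  (\forall t \near a^'+, P t) <-> exists2 e, 0 < e & forall t, a < t -> t < a + e -> P t.
Proof.
split=> [/nbhs_ballP[e /= e0 he]|[e e0 he]].
  exists e => // t at_ te; apply: he => //=.
  by rewrite /ball/= ltr_distlC; apply/andP; split; lra.
near=> t; apply: he; first by near: t; exact: nbhs_right_gt.
by near: t; apply: nbhs_right_lt; rewrite ltrDl.
Unshelve. all: by end_near. Qed.

Lemma near_leftP (a : R) P :
  (\forall t \near a^'-, P t) <-> exists2 e, 0 < e & forall t, a - e < t -> t < a -> P t.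
Proof.
split=> [/nbhs_ballP[e /= e0 he]|[e e0 he]].
  exists e => // t at_ te; apply: he => //=.
  by rewrite /ball/= ltr_distlC; apply/andP; split; lra.
near=> t; apply: he; last by near: t; exact: nbhs_left_lt.
by near: t; apply: nbhs_left_gt; rewrite ltrBlDr ltrDl.
Unshelve. all: by end_near. Qed.

Definition decides (F : set_system R) (P : R -> Prop) :=
  (\forall t \near F, P t) \/ (\forall t \near F, ~ P t).

Lemma decides_or (F : set_system R) {FF : Filter F} P Q :
  decides F P -> decides F Q -> decides F (fun t => P t \/ Q t).
Proof.
move=> [dP _|dP [dQ|dQ]].
- by left; apply: filterS dP => t; left.
- by left; apply: filterS dQ => t; right.
- by right; apply: filterS2 dP dQ => t nP nQ [].
Qed.

Lemma decides_and (F : set_system R) {FF : Filter F} P Q :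
  decides F P -> decides F Q -> decides F (fun t => P t /\ Q t).
Proof.
move=> [dP [dQ|dQ]|dP _].
- by left; apply: filterS2 dP dQ => t.
- by right; apply: filterS dQ => t nQ [].
- by right; apply: filterS dP => t nP [].
Qed.

Lemma decides_ext (F : set_system R) {FF : Filter F} P Q :
  (forall t, P t <-> Q t) -> decides F P -> decides F Q.
Proof.
by move=> PQ [dP|dP]; [left|right]; apply: filterS dP => t; rewrite PQ.
Qed.

Lemma decides_not (F : set_system R) {FF : Filter F} P :
  decides F P -> decides F (fun t => ~ P t).
Proof. by move=> [dP|dP]; [right|left] => //; apply: filterS dP => t /[swap]. Qed.

Lemma decides_itv (F : set_system R) {FF : Filter F} :
  (forall c, decides F (fun t => c < t)) -> (forall c, decides F (fun t => c <= t)) ->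
  forall I : interval R, decides F (fun t => t \in I).
Proof.
move=> dlt dle [l r].
have dT : decides F (fun=> True) by left; exact: filterT.
have dF : decides F (fun=> False) by right; apply: filterS filterT => t _.
apply: (@decides_ext F _ (fun t => (l <= BLeft t)%O /\ (BRight t <= r)%O)).
  by move=> t; rewrite itv_boundlr; split => [[-> ->]|/andP].
apply: decides_and.
  case: l => [[] c|[]].
  - by apply: decides_ext (dle c) => t; rewrite bnd_simp.
  - by apply: decides_ext (dlt c) => t; rewrite bnd_simp.
  - by apply: decides_ext dT => t.
  - by apply: decides_ext dF => t.
case: r => [[] c|[]].
- apply: decides_ext (decides_not (dle c)) => t.
  by rewrite bnd_simp ltNge; split => [/negP|/negP].
- apply: decides_ext (decides_not (dlt c)) => t.
  by rewrite bnd_simp leNgt; split => [/negP|/negP].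
- by apply: decides_ext dF => t.
- by apply: decides_ext dT => t.
Qed.

Lemma decides_right a (I : interval R) : decides a^'+ (fun t => t \in I).
Proof.
apply: decides_itv => c; have [ca|ac] := leP c a.
- left; near=> t; apply: le_lt_trans ca _; near: t; exact: nbhs_right_gt.
- right; near=> t; apply/negP; rewrite -leNgt ltW//; near: t; exact: nbhs_right_lt.
- left; near=> t; apply/ltW/(le_lt_trans ca); near: t; exact: nbhs_right_gt.
- right; near=> t; apply/negP; rewrite -ltNge; near: t; exact: nbhs_right_lt.
Unshelve. all: by end_near. Qed.

Lemma decides_left a (I : interval R) : decides a^'- (fun t => t \in I).
Proof.
apply: decides_itv => c; have [ac|ca] := leP a c.
- right; near=> t; apply/negP; rewrite -leNgt; apply: le_trans ac; apply: ltW.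
  near: t; exact: nbhs_left_lt.
- left; near=> t; near: t; exact: nbhs_left_gt.
- right; near=> t; apply/negP; rewrite -ltNge; apply: lt_le_trans ac.
  near: t; exact: nbhs_left_lt.
- left; near=> t; apply: ltW; near: t; exact: nbhs_left_gt.
Unshelve. all: by end_near. Qed.

Lemma dpred_itvs P : dpred P ->
  exists s : seq (interval R), forall t, P t <-> has (fun I => t \in I) s.
Proof.
move=> /om_dim1[s Ps]; exists s => t.
have -> : P t = [set x : 'rV[R]_1 | P (x 0 0)] (\row__ t) by rewrite /= mxE.
by rewrite Ps /= mxE.
Qed.

Lemma decides_has (F : set_system R) {FF : Filter F} (s : seq (interval R)) :
  (forall I : interval R, decides F (fun t => t \in I)) ->
  decides F (fun t => has (fun I => t \in I) s).
Proof.
move=> dI; elim: s => [|I s ih].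
  by right; apply: filterS filterT => t _.
apply: (@decides_ext F _ (fun t => t \in I \/ has (fun I => t \in I) s)).
  by move=> t; split => /orP.
exact: decides_or.
Qed.

Lemma dpred_right P a : dpred P -> decides a^'+ P.
Proof.
move=> /dpred_itvs[s Ps]; apply: (decides_ext (fun t => iff_sym (Ps t))).
by apply: decides_has; exact: decides_right.
Qed.

Lemma dpred_left P a : dpred P -> decides a^'- P.
Proof.
move=> /dpred_itvs[s Ps]; apply: (decides_ext (fun t => iff_sym (Ps t))).
by apply: decides_has; exact: decides_left.
Qed.

Lemma dpred_measurable P : dpred P -> measurable [set t : R | P t].
Proof.
move=> /dpred_itvs[s Ps].
rewrite (_ : [set t | P t] = \bigcup_(I in [set` s]) [set` I]).
  by apply: fin_bigcup_measurable => //; exact: finite_seq.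
apply/seteqP; split=> [t /Ps/hasP[I sI tI]|t [I sI tI]]; first by exists I.
by apply/Ps/hasP; exists I.
Qed.

Lemma dterm_inf m (P : 'rV[R]_m -> R -> Prop) :
  dform (fun z : 'rV_(m + 1) => P (lsubmx z) (rsubmx z 0 0)) ->
  dterm (fun x => inf [set y | P x y]).
Proof.
move=> dP; pose H x := (exists y, P x y) /\ exists b, forall y, P x y -> b <= y.
apply: (@dterm_graph _ _ _ _ (fun x c => (H x /\ (forall y, P x y -> c <= y) /\
  forall b, (forall y, P x y -> b <= y) -> b <= c) \/ (~ H x /\ c = 0))); last first.
  by rewrite /H; dfn.
move=> x c; have [Hx|nHx] := pselect (H x); last first.
  rewrite inf_out; first by split=> [[[]|[]]|->] //; right.
  by move=> [[y Py] [b Pb]]; apply: nHx; split; [exists y|exists b].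
have hi : has_inf [set y | P x y] by case: Hx => -[y Py] [b Pb]; split; [exists y|exists b].
split=> [[[_ [cl cg]]|[]//]|->].
  apply/eqP; rewrite eq_le; apply/andP; split.
    by apply: lb_le_inf => //; case: hi.
  by apply: cg => y Py; apply: ge_inf => //; case: hi.
left; split=> //; split=> [y Py|b bl]; first by apply: ge_inf => //; case: hi.
by apply: lb_le_inf; [case: hi|].
Qed.

(* The chosen point is the infimum of the nonnegative part of the fibre when it
   is attained, otherwise the midpoint of its leftmost interval, cut at length
   one. *)
Lemma dterm_choice_ge0 m (P : 'rV[R]_m -> R -> Prop) :
  dform (fun z : 'rV_(m + 1) => P (lsubmx z) (rsubmx z 0 0)) ->
  exists c, dterm c /\ forall x, (exists y, P x y /\ 0 <= y) -> P x (c x).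
Proof.
move=> dP.
pose Q x y := P x y /\ 0 <= y.
have dQ : dform (fun z : 'rV_(m + 1) => Q (lsubmx z) (rsubmx z 0 0)) by rewrite /Q; dfn.
pose a x := inf [set y | Q x y].
have da : dterm a := dterm_inf dQ.
pose N x b := a x < b /\ (~ Q x b \/ b = a x + 1).
have dN : dform (fun z : 'rV_(m + 1) => N (lsubmx z) (rsubmx z 0 0)) by rewrite /N; dfn.
pose b x := inf [set y | N x y].
have db : dterm b := dterm_inf dN.
exists (fun x => if `[<Q x (a x)>] then a x else (a x + b x) / 2); split; first by dfn.
move=> x [y Qy]; case: asboolP => [[]//|nQa].
have hi : has_inf [set y | Q x y] by split; [exists y|exists 0 => z []].
have hN : has_inf [set y | N x y].
  split; first by exists (a x + 1); split; [lra|right].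
  by exists (a x) => z []; lra.
have bP z : a x < z -> z < b x -> Q x z.
  move=> az zb; apply: contrapT => nQ.
  by have : b x <= z; [apply: ge_inf; [case: hN|split=> //; left]|lra].
have dQx : dpred (Q x).
  by rewrite /Q /dpred; apply: dform_and; [apply: (dform_app1 dP (u := fun=> x))|]; dfn.
have al z : Q x z -> a x <= z by move=> Qz; apply: ge_inf => //; case: hi.
have [/near_rightP[e e0 he]|/near_rightP[e e0 he]] := dpred_right (a x) dQx; last first.
  have : a x + e <= a x.
    apply: lb_le_inf; first by case: hi.
    move=> z Qz; rewrite leNgt; apply/negP => ze; apply: (he z) => //.
    rewrite lt_neqAle al// andbT; apply/eqP => az; apply: nQa; rewrite az; exact: Qz.
  lra.
have [|] := leP (b x) (a x); last by move=> ab; apply: (bP _ _ _).1; lra.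
have : Num.min (a x + e) (a x + 1) <= b x.
  apply: lb_le_inf; first by case: hN.
  move=> z [az [nQz|->]]; last by rewrite ge_min lexx orbT.
  by rewrite ge_min leNgt; apply/orP; left; apply/negP => ze; apply: nQz; exact: he.
by rewrite /Num.min; case: ifP; lra.
Qed.

Lemma dterm_choice m (P : 'rV[R]_m -> R -> Prop) :
  dform (fun z : 'rV_(m + 1) => P (lsubmx z) (rsubmx z 0 0)) ->
  exists c, dterm c /\ forall x, (exists y, P x y) -> P x (c x).
Proof.
move=> dP; have [c1 [dc1 c1P]] := dterm_choice_ge0 dP.
have [|c2 [dc2 c2P]] := @dterm_choice_ge0 m (fun x y => P x (- y)); first by dfn.
exists (fun x => if `[<exists y, P x y /\ 0 <= y>] then c1 x else - c2 x).
split; first by dfn.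
move=> x [y Py]; case: asboolP => [/c1P//|ny]; apply: c2P; exists (- y).
rewrite opprK; split=> //; rewrite oppr_ge0 leNgt; apply/negP => y0; apply: ny.
by exists y; split=> //; exact: ltW.
Qed.

Lemma dfun_choice (P : R -> R -> Prop) :
  dform (fun z : 'rV_(1 + 1) => P (lsubmx z 0 0) (rsubmx z 0 0)) ->
  exists c, dfun c /\ forall x, (exists y, P x y) -> P x (c x).
Proof.
move=> /(dterm_choice (P := fun x y => P (x 0 0) y))[c [dc cP]].
exists (fun t => c (\row__ t)); split; first by dfn.
by move=> t [y Py]; have := cP (\row__ t); rewrite mxE; apply; exists y.
Qed.

Lemma dmap_choice m k (P : 'rV[R]_m -> 'rV[R]_k -> Prop) :
  dform (fun z : 'rV_(m + k) => P (lsubmx z) (rsubmx z)) ->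
  exists c, dmap c /\ forall x, (exists y, P x y) -> P x (c x).
Proof.
elim: k P => [|k ih] P.
  by move=> dP; exists (fun=> 0); split=> [[]//|x [y]]; rewrite (thinmx0 y).
move: P; rewrite -(addn1 k) => P dP.
pose P' x y := exists y1, P x (row_mx y (\row_(j < 1) y1)).
have [|c' [dc' c'P]] := ih P'; first by rewrite /P'; dfn.
have [|c1 [dc1 c1P]] := @dterm_choice m (fun x y1 => P x (row_mx (c' x) (\row_(j < 1) y1))).
  by dfn.
exists (fun x => row_mx (c' x) (\row_(j < 1) c1 x)); split.
  by dfn.
move=> x [y Py]; apply: c1P; apply: c'P; exists (lsubmx y), (rsubmx y 0 0).
rewrite (_ : \row__ _ = rsubmx y) ?hsubmxK//.
by apply/rowP => j; rewrite mxE (ord1 j).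
Qed.

End DefinableChoiceTheory.

Section RealFunctions.
Variable R : realType.
Implicit Types (g : R -> R) (P : R -> Prop) (a b x y : R).

Lemma pick_right (t x y : R) : t < x -> t < y -> exists s, [/\ t < s, s < x & s < y].
Proof.
move=> tx ty; exists ((t + Num.min x y) / 2).
have : t < Num.min x y by rewrite lt_min tx.
have : Num.min x y <= x by rewrite ge_min lexx.
have : Num.min x y <= y by rewrite ge_min lexx orbT.
by split; lra.
Qed.

Lemma pick_left (t x y : R) : x < t -> y < t -> exists s, [/\ s < t, x < s & y < s].
Proof.
move=> tx ty; have [||s [h1 h2 h3]] := @pick_right (- t) (- x) (- y); do ?lra.
by exists (- s); split; lra.
Qed.

Lemma real_induction P x y : P x ->
  (forall t, x <= t -> t < y -> P t -> \forall s \near t^'+, P s) ->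
  (forall t, x < t -> t <= y -> (forall s, x <= s -> s < t -> P s) -> P t) ->
  forall t, x <= t -> t <= y -> P t.
Proof.
move=> Px Pr Pl t xt ty; apply: contrapT => nPt.
pose A := [set s | x <= s /\ s <= y /\ ~ P s].
have At : A t by [].
have lbA : lbound A x by move=> s [].
have hA : has_inf A by split; [exists t|exists x].
have xm : x <= inf A by apply: lb_le_inf => //; exists t.
have mt : inf A <= t by apply: ge_inf => //; exists x.
have Pm s : x <= s -> s < inf A -> P s.
  move=> xs sm; apply: contrapT => nPs.
  have : inf A <= s by apply: ge_inf; [exists x|split=> //; split=> //; lra].
  by rewrite leNgt sm.
have Pinf : P (inf A).
  have [<-//|neq] := eqVneq x (inf A); apply: Pl => //.
    by rewrite lt_neqAle neq.
  exact: le_trans ty.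
have my : inf A < y.
  rewrite lt_neqAle (le_trans mt ty) andbT; apply/eqP => my; apply: nPt.
  by have -> : t = inf A by lra.
have [e e0 he] := (near_rightP _ _).1 (Pr _ xm my Pinf).
have : inf A + e <= inf A.
  apply: lb_le_inf; first by exists t.
  move=> s As; rewrite leNgt; apply/negP => se; have [xs [sy nPs]] := As.
  apply: nPs; have : inf A <= s by apply: ge_inf => //; exists x.
  by rewrite le_eqVlt => /predU1P[<-//|ms]; exact: he.
lra.
Qed.

Lemma slope_ge g x y c : x <= y ->
  (forall t, x <= t -> t < y -> \forall s \near t^'+, c * (s - t) <= g s - g t) ->
  (forall t e, x < t -> t <= y -> 0 < e -> \forall s \near t^'-, g s <= g t + e) ->
  c * (y - x) <= g y - g x.
Proof.
move=> xy gr gl.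
apply: (@real_induction (fun t => c * (t - x) <= g t - g x) x y) => //.
- by rewrite !subrr mulr0.
- move=> t xt ty Pt; near=> s.
  have : c * (s - t) <= g s - g t by near: s; exact: gr.
  lra.
- move=> t xt ty Ps; apply/ler_addgt0Pr => e e0.
  have e2 : 0 < e / 2 by lra.
  have [e1 e10 he1] := (near_leftP _ _).1 (gl t _ xt ty e2).
  pose d := Num.min (Num.min (t - x) e1) (e / 2 / (`|c| + 1)).
  have c1 : 0 < `|c| + 1 by rewrite ltr_wpDl.
  have d0 : 0 < d by rewrite /d !lt_min subr_gt0 xt e10 divr_gt0.
  have dx : d <= t - x by rewrite /d !ge_min lexx.
  have de : d <= e1 by rewrite /d !ge_min lexx orbT.
  have dc : d * (`|c| + 1) <= e / 2 by rewrite -ler_pdivlMr// /d ge_min lexx orbT.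
  pose s := t - d / 2.
  have st : s < t by rewrite /s; lra.
  have xs : x <= s by rewrite /s; lra.
  have := he1 s; rewrite /s; move=> /(_ ltac:(lra) st) hs.
  have := Ps s xs st; rewrite /s => hp.
  have := ler_norm c; nra.
Unshelve. all: by end_near. Qed.

Lemma itv_uncountable a b : a < b -> ~ countable [set t | a < t /\ t < b].
Proof.
move=> ab /countable_lebesgue_measure0.
rewrite (_ : [set t | _] = `]a, b[%classic); last first.
  by apply/seteqP; split=> t /=; rewrite in_itv/= => /andP.
rewrite lebesgue_measure_itv/= lte_fin ab -EFinB => -[]; lra.
Qed.

Lemma no_strict_local_min g a b : a < b ->
  (forall t, a < t -> t < b -> \forall s \near t^'+, g t < g s) ->
  (forall t, a < t -> t < b -> \forall s \near t^'-, g t < g s) -> False.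
Proof.
move=> ab gr gl; apply: (itv_uncountable ab); set A := [set t | _].
have : forall t, exists q : rat * rat, A t -> [/\ ratr q.1 < t, t < ratr q.2 &
    forall s, ratr q.1 < s -> s < ratr q.2 -> s != t -> g t < g s].
  move=> t; have [[at_ tb]|nA] := pselect (A t); last by exists (0, 0).
  have [e1 e10 he1] := (near_rightP _ _).1 (gr t at_ tb).
  have [e2 e20 he2] := (near_leftP _ _).1 (gl t at_ tb).
  have [|q1] := @rat_in_itvoo R (t - e2) t; first by lra.
  rewrite in_itv/= => /andP[q1l q1r].
  have [|q2] := @rat_in_itvoo R t (t + e1); first by lra.
  rewrite in_itv/= => /andP[q2l q2r].
  exists (q1, q2) => _; split=> //= s s1 s2; rewrite neq_lt => /orP[st|ts].
    by apply: he2 => //; lra.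
  by apply: he1 => //; lra.
move=> /choice[h hP].
have hinj : {in A &, injective h}.
  move=> t t' /set_mem At /set_mem At' htt'.
  have [t1 t2 tg] := hP _ At; have [t1' t2' tg'] := hP _ At'.
  apply/eqP/negPn/negP => tt'.
  have : g t < g t' by apply: tg; rewrite ?htt' // eq_sym.
  have : g t' < g t by apply: tg' => //; rewrite -?htt'.
  lra.
by rewrite -(eq_countable (inj_card_eq hinj)).
Qed.

Lemma locally_increasing g a b :
  (forall t, a < t -> t < b -> \forall s \near t^'+, g t < g s) ->
  (forall t, a < t -> t < b -> \forall s \near t^'-, g s < g t) ->
  forall x y, a < x -> x < y -> y < b -> g x < g y.
Proof.
move=> gr gl x y ax xy yb.
have : y = x \/ g x < g y.
  apply: (@real_induction (fun t => t = x \/ g x < g t) x y) => //.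
  - by left.
  - move=> t xt ty Pt; near=> s; right.
    have gts : g t < g s by near: s; apply: gr; lra.
    by have [<-//|h] := Pt; apply: lt_trans gts.
  - move=> t xt ty Ps; right.
    have [e e0 he] := (near_leftP _ _).1 (gl t ltac:(lra) ltac:(lra)).
    have [s [st xs es]] := @pick_left t x (t - e) xt ltac:(lra).
    have h := he s es st; case: (Ps s) => [||e1|h1]; lra.
  - exact: ltW.
by case=> // yx; move: xy; rewrite yx ltxx.
Unshelve. all: by end_near. Qed.

Lemma locally_constant g a b :
  (forall t, a < t -> t < b -> \forall s \near t^'+, g t = g s) ->
  (forall t, a < t -> t < b -> \forall s \near t^'-, g s = g t) ->
  forall x y, a < x -> x < y -> y < b -> g x = g y.
Proof.
move=> gr gl x y ax xy yb.
apply: (@real_induction (fun t => g x = g t) x y) => //.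
- move=> t xt ty Pt; near=> s; rewrite Pt.
  by near: s; apply: gr; lra.
- move=> t xt ty Ps.
  have [e e0 he] := (near_leftP _ _).1 (gl t ltac:(lra) ltac:(lra)).
  have [s [st xs es]] := @pick_left t x (t - e) xt ltac:(lra).
  by rewrite -(he s es st); apply: Ps => //; exact: ltW.
- exact: ltW.
Unshelve. all: by end_near. Qed.

Definition smono g a b :=
  [\/ forall s t, a < s -> s < t -> t < b -> g s < g t,
      forall s t, a < s -> s < t -> t < b -> g s = g t |
      forall s t, a < s -> s < t -> t < b -> g t < g s].

End RealFunctions.

Section DefinableGerms.
Variables (R : realType) (O : ominimal R).
Local Notation dform := (dform O).
Local Notation dterm := (dterm O).
Local Notation dfun := (dfun O).
Local Notation dpred := (dpred O).
Implicit Types (g : R -> R) (a b : R).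

Lemma dform_near_right m (P : 'rV[R]_m -> R -> Prop) (e : 'rV[R]_m -> R) :
  dterm e -> dform (fun z : 'rV_(m + 1) => P (lsubmx z) (rsubmx z 0 0)) ->
  dform (fun x => \forall s \near (e x)^'+, P x s).
Proof.
move=> de dP; apply: (@dform_ext _ _ _ (fun x => exists d, 0 < d /\
    forall s, e x < s -> s < e x + d -> P x s)); last by dfn.
by move=> x; rewrite near_rightP; split=> [[d [? ?]]|[d]]; exists d.
Qed.

Lemma dform_near_left m (P : 'rV[R]_m -> R -> Prop) (e : 'rV[R]_m -> R) :
  dterm e -> dform (fun z : 'rV_(m + 1) => P (lsubmx z) (rsubmx z 0 0)) ->
  dform (fun x => \forall s \near (e x)^'-, P x s).
Proof.
move=> de dP; apply: (@dform_ext _ _ _ (fun x => exists d, 0 < d /\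
    forall s, e x - d < s -> s < e x -> P x s)); last by dfn.
by move=> x; rewrite near_leftP; split=> [[d [? ?]]|[d]]; exists d.
Qed.

Lemma trichotomy_near (F : set_system R) {FF : ProperFilter F} (P Q S : R -> Prop) :
  decides F P -> decides F Q -> decides F S -> (\forall t \near F, [\/ P t, Q t | S t]) ->
  [\/ \forall t \near F, P t, \forall t \near F, Q t | \forall t \near F, S t].
Proof.
move=> [nP|nP]; first by move=> *; apply: Or31.
move=> [nQ|nQ]; first by move=> *; apply: Or32.
move=> [nS|nS]; first by move=> *; apply: Or33.
move=> h; exfalso; apply: (@filter_not_empty _ F).
by apply: filterS3 (filterI nP nQ) nS h => t [p q] s [].
Qed.

Lemma dfun_trichotomy_right g t c : dfun g -> [\/ \forall s \near t^'+, c < g s,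
  \forall s \near t^'+, c = g s | \forall s \near t^'+, g s < c].
Proof.
move=> dg; apply: trichotomy_near.
- by apply: dpred_right; dfn.
- by apply: dpred_right; dfn.
- by apply: dpred_right; dfn.
- by near=> s; case: (ltgtP c (g s)) => h; [apply: Or31|apply: Or33|apply: Or32].
Unshelve. all: by end_near. Qed.

Lemma dfun_trichotomy_left g t c : dfun g -> [\/ \forall s \near t^'-, c < g s,
  \forall s \near t^'-, c = g s | \forall s \near t^'-, g s < c].
Proof.
move=> dg; apply: trichotomy_near.
- by apply: dpred_left; dfn.
- by apply: dpred_left; dfn.
- by apply: dpred_left; dfn.
- by near=> s; case: (ltgtP c (g s)) => h; [apply: Or31|apply: Or33|apply: Or32].
Unshelve. all: by end_near. Qed.

Lemma dfun_mono_germ g a : dfun g -> exists2 b, a < b & smono g a b.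
Proof.
move=> dg.
have dr (P : R -> R -> Prop) :
    dform (fun z : 'rV_(1 + 1) => P (lsubmx z 0 0) (rsubmx z 0 0)) ->
    decides a^'+ (fun t => \forall s \near t^'+, P t s).
  move=> dP; apply: dpred_right; apply: (@dform_near_right 1 (fun x s => P (x 0 0) s)) => //.
  by dfn.
have dl (P : R -> R -> Prop) :
    dform (fun z : 'rV_(1 + 1) => P (lsubmx z 0 0) (rsubmx z 0 0)) ->
    decides a^'+ (fun t => \forall s \near t^'-, P t s).
  move=> dP; apply: dpred_right; apply: (@dform_near_left 1 (fun x s => P (x 0 0) s)) => //.
  by dfn.
have hr : [\/ \forall t \near a^'+, \forall s \near t^'+, g t < g s,
    \forall t \near a^'+, \forall s \near t^'+, g t = g s |
    \forall t \near a^'+, \forall s \near t^'+, g s < g t].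
  apply: trichotomy_near; do ?[by apply: dr; dfn].
  by near=> t; exact: dfun_trichotomy_right.
have hl : [\/ \forall t \near a^'+, \forall s \near t^'-, g t < g s,
    \forall t \near a^'+, \forall s \near t^'-, g t = g s |
    \forall t \near a^'+, \forall s \near t^'-, g s < g t].
  apply: trichotomy_near; do ?[by apply: dl; dfn].
  by near=> t; exact: dfun_trichotomy_left.
have comb (P Q : R -> Prop) : (\forall t \near a^'+, P t) -> (\forall t \near a^'+, Q t) ->
    exists2 b, a < b & (forall t, a < t -> t < b -> P t) /\ (forall t, a < t -> t < b -> Q t).
  move=> nP nQ; have [e e0 he] := (near_rightP _ _).1 (filterI nP nQ).
  by exists (a + e); [lra|split=> t at_ tb; have [] := he t at_ tb].
(* Constancy on one side of every point excludes strict behaviour on the other. *)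
have rconst b (r : R -> R -> bool) : (forall u, ~~ r u u) -> a < b ->
    (forall t, a < t -> t < b -> \forall s \near t^'+, g t = g s) ->
    (forall t, a < t -> t < b -> \forall s \near t^'-, r (g t) (g s)) -> False.
  move=> rirr ab hR hL; have [t [at_ tb _]] := pick_right ab ab.
  have [e e0 he] := (near_rightP _ _).1 (hR t at_ tb).
  have [s [ts sb se]] := @pick_right _ t b (t + e) ltac:(lra) ltac:(lra).
  have [e' e0' he'] := (near_leftP _ _).1 (hL s ltac:(lra) sb).
  have [u [us tu ue]] := @pick_left _ s t (s - e') ltac:(lra) ltac:(lra).
  have := he' u ue us; rewrite -!he ?(negPf (rirr _))//; lra.
have lconst b (r : R -> R -> bool) : (forall u, ~~ r u u) -> a < b ->
    (forall t, a < t -> t < b -> \forall s \near t^'-, g t = g s) ->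
    (forall t, a < t -> t < b -> \forall s \near t^'+, r (g t) (g s)) -> False.
  move=> rirr ab hL hR; have [t [at_ tb _]] := pick_right ab ab.
  have [e e0 he] := (near_leftP _ _).1 (hL t at_ tb).
  have [s [st as_ es]] := @pick_left _ t a (t - e) ltac:(lra) ltac:(lra).
  have [e' e0' he'] := (near_rightP _ _).1 (hR s as_ ltac:(lra)).
  have [u [su ut ue]] := @pick_right _ s t (s + e') ltac:(lra) ltac:(lra).
  have := he' u su ue; rewrite -!he ?(negPf (rirr _))//; lra.
have ltirr (u : R) : ~~ (u < u) by rewrite ltxx.
case: hr => hR; case: hl => hL; have [b ab [hR' hL']] := comb _ _ hR hL; exists b => //.
- by exfalso; apply: no_strict_local_min hR' hL'.
- by exfalso; apply: (lconst b (fun u v => u < v)).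
- by apply: Or31; exact: locally_increasing.
- by exfalso; apply: (rconst b (fun u v => u < v)).
- apply: Or32; apply: locally_constant hR' _ => t ta tb.
  by apply: filterS (hL' t ta tb) => s.
- by exfalso; apply: (rconst b (fun u v => v < u)).
- apply: Or33 => s t as_ st tb; rewrite -ltrN2.
  apply: (@locally_increasing _ (fun t => - g t) a b) => // u au ub.
    by apply: filterS (hR' u au ub) => v; rewrite ltrN2.
  by apply: filterS (hL' u au ub) => v; rewrite ltrN2.
- by exfalso; apply: (lconst b (fun u v => v < u)).
- exfalso; apply: (@no_strict_local_min _ (fun t => - g t) a b) => // u au ub.
    by apply: filterS (hR' u au ub) => v; rewrite ltrN2.
  by apply: filterS (hL' u au ub) => v; rewrite ltrN2.
Unshelve. all: by end_near. Qed.

End DefinableGerms.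

Section DefinableC1.
Variables (R : realType) (O : ominimal R).
Local Notation dform := (dform O).
Local Notation dfun := (dfun O).
Local Notation dpred := (dpred O).
Implicit Types (g : R -> R) (a b : R).

Definition right_deriv g t d := forall e, 0 < e ->
  \forall s \near t^'+, `|g s - g t - d * (s - t)| <= e * (s - t).

Lemma dform_right_deriv g : dfun g ->
  dform (fun z : 'rV_(1 + 1) => right_deriv g (lsubmx z 0 0) (rsubmx z 0 0)).
Proof.
move=> dg; rewrite /right_deriv; dstep; dstep; first by dfn.
by apply: dform_near_right; dfn.
Qed.

Lemma smono_right_limit (q : R -> R) t b M : t < b -> smono q t b ->
  (\forall s \near t^'+, 0 <= q s <= M) -> exists d : R, q s @[s --> t^'+] --> d.
Proof.
move=> tb qm /near_rightP[e e0 he].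
pose c := Num.min b (t + e).
have tc : t < c by rewrite /c lt_min tb ltrDl.
have cb : c <= b by rewrite /c ge_min lexx.
have ce : c <= t + e by rewrite /c ge_min lexx orbT.
have [nd|ni] : {in `]t, c[ &, nondecreasing_fun q} \/ {in `]t, c[ &, nonincreasing_fun q}.
  case: qm => qm; [left|left|right] => x y; rewrite !in_itv/= => /andP[tx xc] /andP[ty yc];
    rewrite le_eqVlt => /predU1P[->//|xy].
  - by apply/ltW/qm => //; lra.
  - by rewrite (qm _ _ tx xy)//; lra.
  - by apply/ltW/qm => //; lra.
- eexists; apply: nondecreasing_at_right_cvgr nd _; first by rewrite bnd_simp.
  exists 0 => _ [s + <-]; rewrite /= in_itv/= => /andP[ts sc].
  by have /andP[] := he s ts ltac:(lra).
- eexists; apply: nonincreasing_at_right_cvgr ni _; first by rewrite bnd_simp.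
  exists M => _ [s + <-]; rewrite /= in_itv/= => /andP[ts sc].
  by have /andP[] := he s ts ltac:(lra).
Qed.

Lemma nondecreasing_right_deriv_germ g a b0 : dfun g -> a < b0 ->
  (forall s t, a < s -> s < t -> t < b0 -> g s <= g t) ->
  exists2 b, a < b <= b0 & forall t, a < t -> t < b -> exists d, right_deriv g t d.
Proof.
move=> dg ab0 gm.
pose B t := exists M, \forall s \near t^'+, g s - g t <= M * (s - t).
have dB : dpred B.
  rewrite /B /dpred; dstep.
  by apply: (@dform_near_right _ _ _ (fun z s => g s - g (lsubmx z 0 0) <=
    rsubmx z 0 0 * (s - lsubmx z 0 0))); dfn.
have [/near_rightP[e e0 he]|/near_rightP[e e0 he]] := dpred_right a dB; last first.
  have [y [ay yb ye]] := @pick_right _ a b0 (a + e) ab0 ltac:(lra).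
  have [x [ax xy _]] := pick_right ay ay.
  pose c := (g y - g x) / (y - x) + 1.
  have yx : y - x != 0 by apply/eqP; lra.
  have cE : c * (y - x) = g y - g x + (y - x) by rewrite /c mulrDl divfK// mul1r.
  exfalso; suff : c * (y - x) <= g y - g x by lra.
  apply: slope_ge; first exact: ltW.
    move=> t xt ty.
    have [hn|hn] : decides t^'+ (fun s => g s - g t <= c * (s - t)).
      by apply: dpred_right; dfn.
    by exfalso; apply: (he t); [lra|lra|exists c].
    by apply: filterS hn => s /negP; rewrite -ltNge => /ltW.
  move=> t eps xt ty eps0; apply/near_leftP; exists (t - x); first by lra.
  move=> s xs st; apply: ler_wpDr; first exact: ltW.
  by apply: gm; lra.
have [y [ay yb ye]] := @pick_right _ a b0 (a + e) ab0 ltac:(lra).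
exists y; first by apply/andP; split; lra.
move=> t at_ ty; have [M hM] := he t at_ ltac:(lra).
pose q s := (g s - g t) / (s - t).
have dq : dfun q by rewrite /q; dfn.
have [b tb qm] := dfun_mono_germ t dq.
have [|d hd] := @smono_right_limit q t b M tb qm.
  have [e' e0' he'] := (near_rightP _ _).1 hM.
  have [u [tu uy ue]] := @pick_right _ t b0 (t + e') ltac:(lra) ltac:(lra).
  apply/near_rightP; exists (u - t); first by lra.
  move=> s ts su; have st0 : 0 < s - t by lra.
  rewrite /q divr_ge0 ?ler_pdivrMr ?(ltW st0)//=; last first.
    by rewrite subr_ge0; apply: gm; lra.
  by apply: he'; lra.
exists d => eps eps0; have := (cvgrPdist_le _ _).1 hd _ eps0 => hd'.
near=> s.
have st0 : 0 < s - t by rewrite subr_gt0; near: s; exact: nbhs_right_gt.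
have : `|d - q s| <= eps by near: s; exact: hd'.
rewrite distrC /q => h.
rewrite -(divfK (lt0r_neq0 st0) (g s - g t)) -mulrBl normrM (gtr0_norm st0).
by rewrite ler_wpM2r// ltW.
Unshelve. all: by end_near. Qed.

Lemma nondecreasing_left_slope_germ g a b0 : dfun g -> a < b0 ->
  (forall s t, a < s -> s < t -> t < b0 -> g s <= g t) ->
  exists2 b, a < b <= b0 & forall t, a < t -> t < b ->
    exists M, \forall s \near t^'-, g t - g s <= M * (t - s).
Proof.
move=> dg ab0 gm.
pose B t := exists M, \forall s \near t^'-, g t - g s <= M * (t - s).
have dB : dpred B.
  rewrite /B /dpred; dstep.
  by apply: (@dform_near_left _ _ _ (fun z s => g (lsubmx z 0 0) - g s <=
    rsubmx z 0 0 * (lsubmx z 0 0 - s))); dfn.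
have [/near_rightP[e e0 he]|/near_rightP[e e0 he]] := dpred_right a dB; last first.
  have [y [ay yb ye]] := @pick_right _ a b0 (a + e) ab0 ltac:(lra).
  have [x [ax xy _]] := pick_right ay ay.
  pose c := (g y - g x) / (y - x) + 1.
  have yx : y - x != 0 by apply/eqP; lra.
  have cE : c * (y - x) = g y - g x + (y - x) by rewrite /c mulrDl divfK// mul1r.
  exfalso; suff : c * (- x - - y) <= - g (- - x) - - g (- - y) by rewrite !opprK; lra.
  apply: (@slope_ge _ (fun t => - g (- t))); first by lra.
    move=> t xt ty.
    have [hn|hn] : decides (- t)^'- (fun s => g (- t) - g s <= c * (- t - s)).
      by apply: dpred_left; dfn.
    by exfalso; apply: (he (- t)); [lra|lra|exists c].
    have [d d0 hd] := (near_leftP _ _).1 hn.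
    apply/near_rightP; exists d => // s ts sd.
    have := hd (- s) ltac:(lra) ltac:(lra) => /negP; rewrite -ltNge; lra.
  move=> t eps xt ty eps0; apply/near_leftP; exists (t + y); first by lra.
  move=> s xs st; apply: ler_wpDr; first exact: ltW.
  by rewrite lerN2; apply: gm; lra.
have [y [ay yb ye]] := @pick_right _ a b0 (a + e) ab0 ltac:(lra).
exists y; first by apply/andP; split; lra.
by move=> t at_ ty; apply: he => //; lra.
Qed.

Lemma right_deriv_right_cont g t d : right_deriv g t d -> g s @[s --> t^'+] --> g t.
Proof.
move=> gd; apply/cvgrPdist_le => e e0.
near=> s.
have st0 : 0 < s - t by rewrite subr_gt0; near: s; exact: nbhs_right_gt.
have h : `|g s - g t - d * (s - t)| <= 1 * (s - t) by near: s; exact: gd.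
have c1 : 0 < 1 + `|d| by rewrite ltr_pwDl.
have h2 : s < t + e / (1 + `|d|).
  by near: s; apply: nbhs_right_lt; rewrite ltrDl divr_gt0.
have h3 : (s - t) * (1 + `|d|) <= e by rewrite -ler_pdivlMr//; lra.
rewrite distrC; apply: le_trans h3.
rewrite -[X in `|X|](subrK (d * (s - t))); apply: le_trans (ler_normD _ _) _.
by rewrite normrM (gtr0_norm st0); lra.
Unshelve. all: by end_near. Qed.

Lemma left_slope_left_cont g t M a : a < t ->
  (forall s, a < s -> s < t -> g s <= g t) ->
  (\forall s \near t^'-, g t - g s <= M * (t - s)) -> g s @[s --> t^'-] --> g t.
Proof.
move=> at_ gm gM; apply/cvgrPdist_le => e e0.
near=> s.
have st0 : 0 < t - s by rewrite subr_gt0; near: s; exact: nbhs_left_lt.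
have h : g t - g s <= M * (t - s) by near: s; exact: gM.
have c1 : 0 < 1 + `|M| by rewrite ltr_pwDl.
have h2 : t - e / (1 + `|M|) < s.
  by near: s; apply: nbhs_left_gt; rewrite ltrBlDr ltrDl divr_gt0.
have h3 : (t - s) * (1 + `|M|) <= e by rewrite -ler_pdivlMr//; lra.
have h4 : g s <= g t.
  by apply: gm; [near: s; exact: nbhs_left_gt|near: s; exact: nbhs_left_lt].
rewrite ger0_norm ?subr_ge0//; have := ler_norm M; nra.
Unshelve. all: by end_near. Qed.

Lemma continuous_left_right g t : g s @[s --> t^'-] --> g t ->
  g s @[s --> t^'+] --> g t -> {for t, continuous g}.
Proof. by move=> gl gr; apply/left_right_continuousP. Qed.

Lemma right_derivN g t d : right_deriv g t d -> right_deriv (fun s => - g s) t (- d).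
Proof.
move=> gd e e0; apply: filterS (gd e e0) => s.
by rewrite -normrN; congr (`|_| <= _); ring.
Qed.

Lemma nondecreasing_regular_germ g a b0 : dfun g -> a < b0 ->
  (forall s t, a < s -> s < t -> t < b0 -> g s <= g t) ->
  exists2 b, a < b & forall t, a < t -> t < b ->
    (exists d, right_deriv g t d) /\ {for t, continuous g}.
Proof.
move=> dg ab0 gm.
have [b1 /andP[ab1 b10] h1] := nondecreasing_right_deriv_germ dg ab0 gm.
have [b2 /andP[ab2 b20] h2] := nondecreasing_left_slope_germ dg ab0 gm.
have [b [ab bb1 bb2]] := pick_right ab1 ab2.
exists b => // t at_ tb; have [d hd] := h1 t at_ ltac:(lra); split; first by exists d.
have [M hM] := h2 t at_ ltac:(lra).
apply: continuous_left_right (right_deriv_right_cont hd).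
by apply: left_slope_left_cont at_ _ hM => s as_ st; apply: gm => //; lra.
Qed.

Lemma dfun_right_deriv_germ g a : dfun g -> exists2 b, a < b & exists D, dfun D /\
  forall t, a < t -> t < b -> right_deriv g t (D t) /\ {for t, continuous g}.
Proof.
move=> dg.
have [D [dD DP]] := dfun_choice (dform_right_deriv dg).
suff [b ab hb] : exists2 b, a < b & forall t, a < t -> t < b ->
    (exists d, right_deriv g t d) /\ {for t, continuous g}.
  exists b => //; exists D; split=> // t at_ tb; have [h1 h2] := hb t at_ tb.
  by split=> //; exact: DP.
have [b0 ab0 gm] := dfun_mono_germ a dg.
have [gnd|gni] : (forall s t, a < s -> s < t -> t < b0 -> g s <= g t) \/
    (forall s t, a < s -> s < t -> t < b0 -> g t <= g s).
  case: gm => gm; [left|left|right] => s t as_ st tb.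
  - exact/ltW/gm.
  - by rewrite (gm s t).
  - exact/ltW/gm.
- exact: nondecreasing_regular_germ gnd.
- have dNg : dfun (fun t => - g t) by dfn.
  have [|b ab hb] := nondecreasing_regular_germ dNg ab0.
    by move=> s t as_ st tb; rewrite lerN2; exact: gni.
  exists b => // t at_ tb; have [[d hd] hc] := hb t at_ tb; split.
    exists (- d); have := right_derivN hd.
    by congr (right_deriv _ _ _); apply/funext => s; rewrite opprK.
  have : {for t, continuous (fun s => - - g s)} by apply: continuousN.
  by rewrite (_ : (fun s => - - g s) = g)//; apply/funext => s; rewrite opprK.
Qed.

Lemma right_deriv_is_derive g D t (d : R) : 0 < d ->
  (forall u, t - d < u -> u < t + d -> right_deriv g u (D u) /\ {for u, continuous g}) ->
  {for t, continuous D} -> is_derive t 1 g (D t).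
Proof.
move=> d0 gD cD.
have key e : 0 < e -> exists2 r, 0 < r & forall x y, t - r < x -> x < y -> y < t + r ->
    `|g y - g x - D t * (y - x)| <= e * (y - x).
  move=> e0; have e2 : 0 < e / 2 by lra.
  have [r0 /= r00 hr0] := (nbhs_ballP _ _).1 ((cvgrPdist_le _ _).1 cD _ e2).
  have [r [r1 r2 r3]] := @pick_right _ 0 r0 d r00 d0.
  exists r => // x y tx xy yt.
  have gl (h : R -> R) u ep : 0 < ep -> {for u, continuous h} ->
      \forall s \near u^'-, h s <= h u + ep.
    move=> ep0 /left_right_continuousP[hl _].
    have := (cvgrPdist_le _ _).1 hl _ ep0 => {}hl; apply: filterS (hl _) => s.
    by rewrite distrC ler_distl => /andP[].
  have Du u : x <= u -> u < y -> `|D t - D u| <= e / 2.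
    move=> xu uy; apply: hr0; rewrite /ball/= ltr_distlC; apply/andP; split; lra.
  have lo : (D t - e) * (y - x) <= g y - g x.
    apply: slope_ge; first exact: ltW.
      move=> u xu uy; have [gu _] := gD u ltac:(lra) ltac:(lra).
      near=> s.
      have su : 0 < s - u by rewrite subr_gt0; near: s; exact: nbhs_right_gt.
      have : `|g s - g u - D u * (s - u)| <= e / 2 * (s - u) by near: s; exact: gu.
      rewrite ler_norml => /andP[h _].
      have := Du u xu uy; rewrite ler_norml => /andP[_ h']; nra.
    by move=> u ep xu uy ep0; apply: gl => //; have [] := gD u ltac:(lra) ltac:(lra).
  have hi : (- D t - e) * (y - x) <= - g y - - g x.
    apply: (@slope_ge _ (fun s => - g s)); first exact: ltW.
      move=> u xu uy; have [gu _] := gD u ltac:(lra) ltac:(lra).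
      near=> s.
      have su : 0 < s - u by rewrite subr_gt0; near: s; exact: nbhs_right_gt.
      have : `|g s - g u - D u * (s - u)| <= e / 2 * (s - u) by near: s; exact: gu.
      rewrite ler_norml => /andP[_ h].
      have := Du u xu uy; rewrite ler_norml => /andP[h' _]; nra.
    move=> u ep xu uy ep0; apply: (gl (fun s => - g s)) => //.
    by apply: continuousN; have [] := gD u ltac:(lra) ltac:(lra).
  rewrite ler_norml; apply/andP; split; lra.
have gc : h^-1 *: (g (h *: 1 + t) - g t) @[h --> 0^'] --> D t.
  apply/cvgrPdist_le => e e0; have [r r0 hr] := key e e0.
  near=> h.
  have h0 : h != 0 by near: h; exact: nbhs_dnbhs_neq.
  have hr' : `|h| < r by near: h; exact: dnbhs0_lt.
  move: hr'; rewrite ltr_norml => /andP[hl hu].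
  have -> : D t - h^-1 *: (g (h *: 1 + t) - g t) =
      - (h^-1 * (g (h + t) - g t - D t * h)).
    by rewrite /GRing.scale/= mulr1; field.
  rewrite normrN normrM normfV mulrC ler_pdivrMr ?normr_gt0//.
  move: h0; rewrite neq_lt => /orP[hneg|hpos].
    rewrite (ltr0_norm hneg).
    have := hr (h + t) t ltac:(lra) ltac:(lra) ltac:(lra).
    rewrite -normrN; have -> : - (g t - g (h + t) - D t * (t - (h + t))) =
      g (h + t) - g t - D t * h by ring.
    by have -> : t - (h + t) = - h by ring.
  rewrite (gtr0_norm hpos).
  have := hr t (h + t) ltac:(lra) ltac:(lra) ltac:(lra).
  by have -> : h + t - t = h by ring.
apply: DeriveDef; first by apply/cvg_ex; exists (D t).
by apply/cvg_lim.
Unshelve. all: by end_near. Qed.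

Lemma dfun_C1_germ g a : dfun g -> exists2 b, a < b & smono g a b /\
  exists D, dfun D /\ forall t, a < t -> t < b ->
    is_derive t 1 g (D t) /\ {for t, continuous D}.
Proof.
move=> dg.
have [b1 ab1 [D [dD hD]]] := dfun_right_deriv_germ a dg.
have [b2 ab2 [D' [_ hD']]] := dfun_right_deriv_germ a dD.
have [b3 ab3 gm] := dfun_mono_germ a dg.
have [b' [ab' bb1 bb2]] := pick_right ab1 ab2.
have [b [ab bb' bb3]] := pick_right ab' ab3.
exists b => //; split.
  by case: gm => gm; [apply: Or31|apply: Or32|apply: Or33] => s t as_ st tb; apply: gm => //; lra.
exists D; split=> // t at_ tb; have [_ cD] := hD' t at_ ltac:(lra); split=> //.
have [d [d0 d1 d2]] := @pick_right _ 0 (t - a) (b1 - t) ltac:(lra) ltac:(lra).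
by apply: (right_deriv_is_derive d0) => // u tu ut; apply: hD; lra.
Qed.

End DefinableC1.

Section IntegralComparison.
Local Open Scope ereal_scope.
Variables (R : realType) (disp : measure_display) (T : measurableType disp).
Variable mu : {measure set T -> \bar R}.
Implicit Types (f g : T -> \bar R) (D : set T).

Lemma ge0_le_integral_raw D f g : (forall x, D x -> 0 <= f x) ->
  (forall x, D x -> f x <= g x) -> \int[mu]_(x in D) f x <= \int[mu]_(x in D) g x.
Proof.
move=> f0 fg; rewrite !ge0_integralE//; last first.
  by move=> x Dx; exact: le_trans (f0 x Dx) (fg x Dx).
apply: ereal_sup_le => _ [h hf <-]; exists h => // x.
by apply: le_trans (hf x) _; rewrite !patchE; case: ifP => // /set_mem; exact: fg.
Qed.

(* No measurability is needed, the integral of a nonnegative function being the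
   supremum of the integrals of the simple functions below it. *)
Lemma le_integral_raw D f g :
  (forall x, D x -> f x <= g x) -> \int[mu]_(x in D) f x <= \int[mu]_(x in D) g x.
Proof.
move=> fg; rewrite integralE [leRHS]integralE; apply: leeB;
  apply: ge0_le_integral_raw => x Dx; rewrite ?funeposE ?funenegE//.
- by rewrite le_max lexx orbT.
- by rewrite ge_max !le_max fg// lexx orbT.
- by rewrite le_max lexx orbT.
- by rewrite ge_max !le_max leeN2 fg// lexx orbT.
Qed.

Lemma integrable_fin_integral D f : measurable D -> measurable_fun D f ->
  \int[mu]_(x in D) f x \is a fin_num -> mu.-integrable D f.
Proof.
move=> mD mf; rewrite integralE fin_numB => /andP[fp fn].
apply/integrableP; split=> //.
have -> : \int[mu]_(x in D) `|f x| = \int[mu]_(x in D) (f^\+ x + f^\- x).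
  by apply: eq_integral => x _; have := congr1 (fun h => h x) (fune_abse f).
rewrite ge0_integralD//; first by rewrite lte_add_pinfty// -ge0_fin_numE// integral_ge0.
- exact: measurable_funepos.
- exact: measurable_funeneg.
Qed.

End IntegralComparison.

Section FinitePatch.
Variable R : realType.
Local Notation mu := (@lebesgue_measure R).

Lemma measurable_fun_finite_patch (s : seq R) (f Q : R -> R) :
  (forall x, x \notin s -> f x = Q x) -> measurable_fun setT Q -> measurable_fun setT f.
Proof.
elim: s f => [|y s ih] f fQ mQ; first by rewrite (_ : f = Q)//; apply/funext => x; exact: fQ.
pose f' x := if x == y then Q y else f x.
have mf' : measurable_fun setT f'.
  apply: ih mQ => x xs; rewrite /f'; case: eqVneq => [->//|xy].
  by apply: fQ; rewrite inE negb_or xy.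
rewrite (_ : f = fun x => if x == y then f y else f' x); last first.
  by apply/funext => x; rewrite /f'; case: eqVneq => [->|].
apply: measurable_fun_ifT => //.
apply: (measurable_fun_bool true); rewrite setTI.
rewrite (_ : _ @^-1` _ = [set y]); first exact: measurable_set1.
by apply/seteqP; split=> x /= /eqP.
Qed.

Lemma integral_finite_patch (D : set R) (s : seq R) (f g : R -> R) : measurable D ->
  measurable_fun setT f -> measurable_fun setT g ->
  (forall x, D x -> x \notin s -> f x = g x) ->
  (\int[mu]_(x in D) (f x)%:E = \int[mu]_(x in D) (g x)%:E)%E.
Proof.
move=> mD mf mg fg; apply: ae_eq_integral => //.
- exact/measurable_EFinP/measurable_funTS.
- exact/measurable_EFinP/measurable_funTS.
exists [set` s]; split.
- rewrite (_ : [set` s] = \bigcup_(x in [set` s]) [set x]); last first.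
    by apply/seteqP; split=> [x xs|x [y ys ->]]//; exists x.
  by apply: fin_bigcup_measurable => //; exact: finite_seq.
- by apply: countable_lebesgue_measure0; apply: finite_set_countable; exact: finite_seq.
- move=> x /= h; apply: contrapT => /negP xs; apply: h => Dx.
  by rewrite fg.
Qed.

End FinitePatch.

Section Vectors.
Variables (R : realType) (p : nat).
Implicit Types u v : 'rV[R]_p.

Lemma enorm_ge0 u : 0 <= enorm u.
Proof. exact: sqrtr_ge0. Qed.

Lemma coord_le_enorm u i : `|u 0 i| <= enorm u.
Proof.
rewrite /enorm /dotp -sqrtr_sqr ler_wsqrtr// (bigD1 i)//= expr2 lerDl.
by apply: sumr_ge0 => j _; rewrite -expr2 sqr_ge0.
Qed.

Lemma enorm_le_sum u : enorm u <= \sum_i `|u 0 i|.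
Proof.
have S0 : 0 <= \sum_i `|u 0 i| by apply: sumr_ge0.
rewrite -(ger0_norm S0) -sqrtr_sqr ler_wsqrtr// expr2 mulr_suml.
apply: ler_sum => i _; rewrite -expr2 -real_normK ?num_real// expr2.
by rewrite ler_wpM2l// (bigD1 i)//= lerDl sumr_ge0.
Qed.

Lemma dotp_le u v : `|dotp u v| <= (\sum_i `|u 0 i|) * enorm v.
Proof.
apply: le_trans (ler_norm_sum _ _ _) _; rewrite mulr_suml; apply: ler_sum => i _.
by rewrite normrM ler_wpM2l// coord_le_enorm.
Qed.

Lemma derive1_mx (g : R -> 'rV[R]_p) (t : R) (d : 'rV[R]_p) :
  (forall i, is_derive t 1 (fun s => g s 0 i) (d 0 i)) -> derive1 g t = d.
Proof.
move=> gd; rewrite derive1E derive_mx.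
  by apply/rowP => i; rewrite mxE; exact: derive_val.
by apply/derivable_mxP => i j; rewrite (ord1 i); case: (gd j).
Qed.

End Vectors.

Section LowerBound.
Variables (R : realType) (O : ominimal R) (p : nat).
Variables (D : 'rV[R]_p -> set 'rV[R]_p) (f : 'rV[R]_p -> R).
Hypotheses (Df : conservative_field_for D f) (dD : definable_setfun O D).
Local Notation dfun := (dfun O).
Local Notation mu := (@lebesgue_measure R).

Lemma lipschitz_abs_cont (g : R -> 'rV[R]_p) (L : R) : 0 <= L ->
  (forall i s t, 0 <= s -> s <= t -> t <= 1 -> `|g t 0 i - g s 0 i| <= L * (t - s)) ->
  abs_cont_01 g.
Proof.
move=> L0 gL e e0; pose M := p%:R * L + 1.
have M0 : 0 < M by rewrite ltr_wpDl// mulr_ge0.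
exists (e / M); first by rewrite divr_gt0.
move=> n a b hab _; rewrite ltr_pdivlMr// => hs.
apply: le_lt_trans hs; rewrite mulr_suml; apply: ler_sum => i _.
have [a0 [ab b1]] := hab i (ltn_ord i).
apply: le_trans (enorm_le_sum _) _.
apply: (@le_trans _ _ (\sum_(j < p) L * (b i - a i))).
  by apply: ler_sum => j _; rewrite !mxE; exact: gL.
rewrite sumr_const card_ord -mulr_natl mulrA mulrC ler_wpM2l ?subr_ge0//.
by rewrite /M lerDl.
Qed.

Lemma dfun_measurable (g : R -> R) : dfun g -> measurable_fun setT g.
Proof.
move=> dg; apply: (measurability (@RGenOInfty.G R)) => //.
  exact: RGenOInfty.measurableE.
move=> _ [_ [x ->] <-]; rewrite setTI.
have -> : g @^-1` `]x, +oo[ = [set t | x < g t].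
  by apply/seteqP; split=> t /=; rewrite in_itv/= andbT.
by apply: (@dpred_measurable _ O); dfn.
Qed.

Definition line_then (c : R -> 'rV[R]_p) (s : R) : 'rV[R]_p :=
  if s <= 1 / 2 then (2 * s) *: c 0 else c (2 * s - 1).

Lemma line_then_abs_cont (c : R -> 'rV[R]_p) (L : R) :
  (forall i s t, 0 <= s -> s <= t -> t <= 1 -> `|c t 0 i - c s 0 i| <= L * (t - s)) ->
  abs_cont_01 (line_then c).
Proof.
move=> cL; pose M := \sum_i `|c 0 0 i|.
have Mi i : `|c 0 0 i| <= M by rewrite /M (bigD1 i)//= lerDl sumr_ge0.
have M0 : 0 <= M by apply: sumr_ge0.
pose K := 2 * (M + `|L|).
have K0 : 0 <= K by rewrite mulr_ge0// addr_ge0.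
apply: (@lipschitz_abs_cont _ K) => // i s t s0 st t1; rewrite /line_then.
have L0 := ler_norm L; have La := normr_ge0 L.
have low a b : a <= b -> `|(2 * b) * c 0 0 i - (2 * a) * c 0 0 i| <= K * (b - a).
  move=> ab; rewrite -mulrBl -mulrBr normrM ger0_norm; last by lra.
  have := Mi i; rewrite /K; nra.
have high a b : 1 / 2 <= a -> a <= b -> b <= 1 ->
    `|c (2 * b - 1) 0 i - c (2 * a - 1) 0 i| <= K * (b - a).
  move=> ha ab b1; apply: le_trans (cL i _ _ _ _ _) _; rewrite /K; do ?lra.
  nra.
case: ifPn => ht; case: ifPn => hs; do ?rewrite mxE.
- exact: low.
- by exfalso; move: hs; rewrite -ltNge; lra.
- have h1 := low s (1 / 2) hs; have h2 := high (1 / 2) t (lexx _) _ t1.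
  move: ht; rewrite -ltNge => ht.
  have e1 : 2 * (1 / 2) = 1 :> R by field.
  move: h1 h2; rewrite e1 subrr (mul1r (c 0 0 i)) => h1 /(_ (ltW ht)) h2.
  apply: le_trans (ler_distD (c 0 0 i) _ _) _; lra.
- move: hs; rewrite -ltNge => /ltW hs; exact: high.
Qed.

Lemma line_then_integral (c : R -> 'rV[R]_p) (L : R) :
  (forall i s t, 0 <= s -> s <= t -> t <= 1 -> `|c t 0 i - c s 0 i| <= L * (t - s)) ->
  ((f (c 1) - f 0)%:E = path_integral D (line_then c))%E.
Proof.
move=> cL; have [_ /(_ (c 1) (line_then c)) h] := Df.
apply: h; first exact: line_then_abs_cont cL.
- rewrite /line_then ifT; first by rewrite mulr0 scale0r.
  by lra.
- rewrite /line_then ifF; first by congr c; ring.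
  by apply/negP; lra.
Qed.

Lemma line_then_low (c : R -> 'rV[R]_p) (s : R) : 0 < s -> s < 1 / 2 ->
  supp_integrand D (line_then c) s = sup [set dotp (2 *: c 0) v | v in D ((2 * s) *: c 0)].
Proof.
move=> s0 s1; rewrite /supp_integrand.
have -> : derive1 (line_then c) s = 2 *: c 0.
  apply: derive1_mx => i; apply: (@near_eq_is_derive _ R R (fun u => 2 * u * c 0 0 i)).
  - near=> u; rewrite /line_then ifT ?mxE//; apply: ltW.
    by near: u; exact: lt_nbhsl.
  - have : is_derive s 1 (fun u : R => (c 0 0 i * 2) *: (u : R)) ((c 0 0 i * 2) *: 1).
      exact: is_deriveZ.
    rewrite (_ : (fun u : R => _ *: _) = (fun u => 2 * u * c 0 0 i)).
      by move=> h; apply: is_derive_eq h _; rewrite mxE /GRing.scale/=; ring.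
    by apply/funext => u; rewrite /GRing.scale/=; ring.
by rewrite /line_then ifT// ltW.
Unshelve. all: by end_near. Qed.

Lemma line_then_high (c : R -> 'rV[R]_p) (s : R) (d : 'rV[R]_p) : 1 / 2 < s ->
  (forall i, is_derive (2 * s - 1) 1 (fun u => c u 0 i) (d 0 i)) ->
  supp_integrand D (line_then c) s = sup [set dotp (2 *: d) v | v in D (c (2 * s - 1))].
Proof.
move=> s1 cd; rewrite /supp_integrand.
have -> : derive1 (line_then c) s = 2 *: d.
  apply: derive1_mx => i; apply: (@near_eq_is_derive _ R R (fun u => c (2 * u - 1) 0 i)).
  - near=> u; rewrite /line_then ifF//; apply/negbTE; rewrite -ltNge.
    by near: u; exact: lt_nbhsr.
  - have h1 : is_derive s 1 (fun u : R => 2 * u - 1) 2.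
      have : is_derive s 1 (fun u : R => 2 *: u - 1) (2 *: 1 - 0).
        apply: is_deriveB; exact: is_deriveZ.
      by move=> h; apply: is_derive_eq h _; rewrite /GRing.scale/= mulr1 subr0.
    have := @is_derive1_comp _ (fun u => c u 0 i) (fun u : R => 2 * u - 1) s _ _ (cd i) h1.
    by move=> h; apply: is_derive_eq h _; rewrite mxE mulrC.
by rewrite /line_then ifF//; apply/negbTE; rewrite -ltNge.
Unshelve. all: by end_near. Qed.

Lemma dotpZl (a : R) (u v : 'rV[R]_p) : dotp (a *: u) v = a * dotp u v.
Proof. by rewrite /dotp mulr_sumr; apply: eq_bigr => i _; rewrite mxE mulrA. Qed.

Lemma dfun_line_sup (u : 'rV[R]_p) : dfun (fun s =>
  if `[<s < 1 / 2>] then sup [set dotp (2 *: u) v | v in D ((2 * s) *: u)] else 0).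
Proof.
apply: dterm_if; dfn.
have : dterm O (fun x : 'rV[R]_1 => - inf [set y | exists v,
    D (\row_j (2 * x 0 0 * u 0 j)) v /\ y = - dotp (2 *: u) v]).
  apply: dterm_opp; apply: dterm_inf; by dfn.
apply: dterm_ext => x; rewrite /inf opprK; congr sup; apply/seteqP; split.
  move=> _ [_ [v [Dv ->]] <-]; rewrite opprK; exists v => //.
  by congr (D _ v): Dv; apply/rowP => j; rewrite !mxE.
move=> _ [v Dv <-]; exists (- dotp (2 *: u) v); last by rewrite opprK.
by exists v; split=> //; congr (D _ v): Dv; apply/rowP => j; rewrite !mxE.
Qed.

Lemma dotp_le_sup (x u v : 'rV[R]_p) : D x v -> dotp u v <= sup [set dotp u w | w in D x].
Proof.
move=> Dv; apply: ub_le_sup; last by exists v.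
have [[_ [cD _]] _] := Df; have [_ cx] := cD x.
have [M [_ hM]] := compact_bounded cx.
exists ((\sum_i `|u 0 i|) * (p%:R * (M + 1))) => _ [w Dw <-].
apply: le_trans (ler_norm _) _; apply: le_trans (dotp_le _ _) _.
rewrite ler_wpM2l ?sumr_ge0//; apply: le_trans (enorm_le_sum _) _.
rewrite mulr_natl -[in leRHS](card_ord p) -sumr_const; apply: ler_sum => i _.
have := hM (M + 1) ltac:(by rewrite ltrDl) w Dw; apply: le_trans.
rewrite [leRHS]/Num.Def.normr/= mx_normrE.
exact: (le_bigmax _ (fun ij : 'I_1 * 'I_p => `|w ij.1 ij.2|) (0, i)).
Qed.

Lemma path_lower_bound (c d : R -> 'rV[R]_p) (L K : R) : 0 <= K ->
  (forall i (s : R), 0 <= s -> s <= 1 -> is_derive s 1 (fun u => c u 0 i) (d s 0 i)) ->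
  (forall i s, 0 <= s -> s <= 1 -> `|d s 0 i| <= L) ->
  (forall s, 0 < s -> s < 1 -> exists2 v, D (c s) v & - K <= dotp (d s) v) ->
  - (2 * K) <= f (c 1) - f (c 0).
Proof.
move=> K0 cd dL hv.
have cL i s t : 0 <= s -> s <= t -> t <= 1 -> `|c t 0 i - c s 0 i| <= L * (t - s).
  move=> s0 st t1; have [x|x|x /[!in_itv]/= /andP[sx xt] ->] :=
      @MVT_segment _ (fun u => c u 0 i) (fun u => d u 0 i) s t st.
  - by rewrite in_itv/= => /andP[sx xt]; apply: cd; lra.
  - apply: derivable_within_continuous => y; rewrite in_itv/= => /andP[sy yt].
    by have [] := cd i y ltac:(lra) ltac:(lra).
  - rewrite normrM [X in _ * X]ger0_norm ?subr_ge0// ler_wpM2r ?subr_ge0//.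
    by apply: dL; lra.
pose c0 := fun _ : R => c 0.
have c0L i s t : 0 <= s -> s <= t -> t <= 1 -> `|c0 t 0 i - c0 s 0 i| <= 0 * (t - s).
  by rewrite subrr normr0 mul0r.
have I1 := line_then_integral cL; have I0 := line_then_integral c0L.
pose Q s := if `[<s < 1 / 2>] then
  sup [set dotp (2 *: c 0) v | v in D ((2 * s) *: c 0)] else 0.
have mQ : measurable_fun setT Q by apply: dfun_measurable; exact: dfun_line_sup.
pose N : seq R := [:: 0; 1 / 2; 1].
pose F0 := supp_integrand D (line_then c0).
pose F1 := supp_integrand D (line_then c).
have inN s : s \notin N -> 0 <= s -> s <= 1 -> (0 < s /\ s < 1 / 2) \/ (1 / 2 < s /\ s < 1).
  rewrite !inE !negb_or => /and3P[s0 s2 s1] h0 h1.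
  have [h|h|h] := ltgtP s (1 / 2); [left|right|].
  - by split=> //; rewrite lt_neqAle eq_sym s0.
  - by split=> //; rewrite lt_neqAle s1.
  - by rewrite h eqxx in s2.
have F0Q s : s \notin N -> 0 <= s -> s <= 1 -> F0 s = Q s.
  move=> sN s0 s1; rewrite /F0 /Q; have [[h0 h1]|[h0 h1]] := inN s sN s0 s1.
    by rewrite line_then_low//; case: asboolP.
  have h i : is_derive (2 * s - 1) 1 (fun u => c0 u 0 i) ((0 : 'rV[R]_p) 0 i).
    by rewrite mxE; exact: is_derive_cst.
  rewrite (line_then_high h0 h).
  rewrite (_ : [set _ | _ in _] = [set 0]); last first.
    have [[_ [cD _]] _] := Df; have [[v Dv] _] := cD (c0 (2 * s - 1)).
    apply/seteqP; split=> [_ [w _ <-]|_ ->]; first by rewrite dotpZl /dotp big1 ?mulr0// => i _; rewrite mxE mul0r.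
    by exists v => //; rewrite dotpZl /dotp big1 ?mulr0// => i _; rewrite mxE mul0r.
  rewrite sup1; case: asboolP => // hs; exfalso; lra.
have F1Q s : s \notin N -> 0 <= s -> s <= 1 -> Q s - 2 * K <= F1 s.
  move=> sN s0 s1; rewrite /F1 /Q; have [[h0 h1]|[h0 h1]] := inN s sN s0 s1.
    by rewrite line_then_low//; case: asboolP => // _; lra.
  have h i : is_derive (2 * s - 1) 1 (fun u => c u 0 i) (d (2 * s - 1) 0 i).
    by apply: cd; lra.
  rewrite (line_then_high h0 h).
  have [v Dv hvK] := hv (2 * s - 1) ltac:(lra) ltac:(lra).
  have := dotp_le_sup (2 *: d (2 * s - 1)) Dv; rewrite dotpZl.
  by case: asboolP => [hs|_]; [exfalso; lra|lra].
pose in01 (s : R) := (0 <= s) && (s <= 1).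
pose F0' s := if in01 s && (s \in N) then F0 s else Q s.
pose F1' s := if in01 s && (s \in N) then F1 s else Q s - 2 * K.
have mF0' : measurable_fun setT F0'.
  apply: (@measurable_fun_finite_patch _ N) mQ => s /negPf sN; by rewrite /F0' sN andbF.
have mF1' : measurable_fun setT F1'.
  apply: (@measurable_fun_finite_patch _ N _ (fun s => Q s - 2 * K)).
    by move=> s /negPf sN; rewrite /F1' sN andbF.
  by apply: measurable_funB.
have mI : measurable (`[0, 1] : set R) by exact: measurable_itv.
have E0 : (\int[mu]_(s in `[0%R, 1%R]) (Q s)%:E = (f (c 0) - f 0)%:E)%E.
  have e : (\int[mu]_(s in `[0%R, 1%R]) (F0' s)%:E = \int[mu]_(s in `[0%R, 1%R]) (Q s)%:E)%E.
    apply: (@integral_finite_patch _ _ N) => // s _ /negPf sN.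
    by rewrite /F0' sN andbF.
  rewrite -e [RHS]I0 /path_integral.
  apply: eq_integral => s /set_mem; rewrite /= in_itv/= => s01.
  rewrite /F0' /in01 s01/=; case: ifPn => // sN; congr EFin.
  by move/andP: s01 => [? ?]; rewrite -F0Q.
have iQ : mu.-integrable `[0, 1] (EFin \o Q).
  apply: integrable_fin_integral => //; last by rewrite E0.
  exact/measurable_EFinP/measurable_funTS.
have E1 : (\int[mu]_(s in `[0%R, 1%R]) (F1' s)%:E = (f (c 0) - f 0 - 2 * K)%:E)%E.
  have -> : (\int[mu]_(s in `[0%R, 1%R]) (F1' s)%:E =
      \int[mu]_(s in `[0%R, 1%R]) (Q s - 2 * K)%:E)%E.
    apply: (@integral_finite_patch _ _ N) => //; first exact: measurable_funB.
    by move=> s _ /negPf sN; rewrite /F1' sN andbF.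
  under eq_integral do rewrite EFinB.
  have Ek : (\int[mu]_(s in `[0%R, 1%R]) (2 * K)%:E = (2 * K)%:E)%E.
    have mu1 : mu (`[0%R, 1%R] : set R) = 1%E.
      by rewrite lebesgue_measure_itv/= lte_fin ltr01 -EFinB subr0.
    by have := @integral_cst _ _ _ mu _ mI (2 * K)%:E; rewrite [X in (_ * X)%E]mu1 mule1.
  rewrite integralB_EFin//; first by rewrite E0 Ek -EFinB.
  apply: integrable_fin_integral => //; first exact: measurable_cst.
  by rewrite (_ : integral _ _ _ = (2 * K)%:E)//; exact: Ek.
have : ((f (c 0) - f 0 - 2 * K)%:E <= (f (c 1) - f 0)%:E)%E.
  rewrite I1 -E1 /path_integral; apply: le_integral_raw => s; rewrite /= in_itv/= => s01.
  rewrite lee_fin /F1' /in01 s01/=; case: ifPn => // sN.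
  by move/andP: s01 => [? ?]; exact: F1Q.
by rewrite lee_fin; lra.
Qed.

End LowerBound.

Section Mvt.
Variable R : realType.
Implicit Types (g h : R -> R).

Lemma mvt_open g h (a b s t : R) : (forall u : R, a < u -> u < b -> is_derive u 1 g (h u)) ->
  a < s -> s < t -> t < b -> exists2 u, s < u < t & g t - g s = h u * (t - s).
Proof.
move=> gh as_ st tb; have [u|| u + ->] := @MVT _ g h s t st.
- by rewrite in_itv/= => /andP[su ut]; apply: gh; lra.
- apply: derivable_within_continuous => u; rewrite in_itv/= => /andP[su ut].
  by have [] := gh u ltac:(lra) ltac:(lra).
- by rewrite in_itv/= => ?; exists u.
Qed.

Definition C1_at g h (t : R) := is_derive t 1 g (h t) /\ {for t, continuous h}.

Lemma is_derive_continuous g (t d : R) : is_derive t 1 g d -> {for t, continuous g}.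
Proof. by move=> [gd _]; apply: differentiable_continuous; exact/derivable1_diffP. Qed.

End Mvt.

Section CurveSpeed.
Variables (R : realType) (O : ominimal R) (p : nat).
Variables (D : 'rV[R]_p -> set 'rV[R]_p) (f : 'rV[R]_p -> R).
Hypotheses (Df : conservative_field_for D f) (dD : definable_setfun O D).

Lemma curve_speed (x u v : R -> 'rV[R]_p) (a b K : R) : 0 <= K -> a <= b ->
  (forall i (t : R), a <= t -> t <= b -> is_derive t 1 (fun s => x s 0 i) (u t 0 i)) ->
  (forall i (t : R), a <= t -> t <= b -> {for t, continuous (fun s => u s 0 i)}) ->
  (forall t, a <= t -> t <= b -> D (x t) (v t) /\ `|dotp (u t) (v t)| <= K) ->
  `|f (x b) - f (x a)| <= 2 * K * (b - a).
Proof.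
move=> K0 ab xu cu hv.
have [L hL] : exists L, forall i t, a <= t -> t <= b -> `|u t 0 i| <= L.
  have : forall i, exists L, forall t, a <= t -> t <= b -> `|u t 0 i| <= L.
    move=> i; have [|c _ hc] := @EVT_max R (fun t => `|u t 0 i|) a b ab.
      apply: continuous_in_subspaceT => t /set_mem; rewrite /= in_itv/= => /andP[at_ tb].
      by apply: continuous_comp; [exact: cu|exact: norm_continuous].
    by exists `|u c 0 i| => t at_ tb; apply: hc; rewrite in_itv/= at_.
  move=> /choice[L hL]; exists (\sum_i `|L i|) => i t at_ tb.
  apply: le_trans (hL i t at_ tb) _; apply: le_trans (ler_norm _) _.
  by rewrite (bigD1 i)//= lerDl sumr_ge0.
have key t0 h : a <= t0 -> t0 <= b -> a <= t0 + h -> t0 + h <= b ->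
    - (2 * (K * `|h|)) <= f (x (t0 + h)) - f (x t0).
  move=> at0 t0b ath thb.
  have seg s : 0 <= s -> s <= 1 -> a <= t0 + s * h /\ t0 + s * h <= b.
    by move=> s0 s1; split; nra.
  have := @path_lower_bound R O p D f Df dD (fun s => x (t0 + s * h))
    (fun s => h *: u (t0 + s * h)) (`|h| * L) (K * `|h|).
  rewrite mul1r mul0r addr0; apply.
  - by rewrite mulr_ge0.
  - move=> i s s0 s1; have [h1 h2] := seg s s0 s1.
    have hlin : is_derive s 1 (fun s : R => t0 + s * h) h.
      have : is_derive s 1 (fun s : R => t0 + h *: s) (0 + h *: 1).
        by apply: is_deriveD; exact: is_deriveZ.
      rewrite (_ : (fun s : R => t0 + h *: s) = (fun s : R => t0 + s * h)); last first.
        by apply/funext => r; rewrite /GRing.scale/= mulrC.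
      by move=> hd; apply: is_derive_eq hd _; rewrite /GRing.scale/= mulr1 add0r.
    have := @is_derive1_comp _ (fun s => x s 0 i) (fun s : R => t0 + s * h) s _ _
      (xu i _ h1 h2) hlin.
    by move=> hd; apply: is_derive_eq hd _; rewrite mxE mulrC.
  - move=> i s s0 s1; have [h1 h2] := seg s s0 s1.
    by rewrite mxE normrM ler_wpM2l// hL.
  - move=> s s0 s1; have [h1 h2] := seg s (ltW s0) (ltW s1).
    have [Dv Kv] := hv _ h1 h2; exists (v (t0 + s * h)) => //.
    rewrite dotpZl; have := ler_wpM2r (normr_ge0 h) Kv; rewrite -normrM => hk.
    have := lerNnormlW hk; rewrite mulrC; lra.
rewrite ler_norml; apply/andP; split.
  have := @key a (b - a) ltac:(lra) ab ltac:(lra) ltac:(lra).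
  rewrite ger0_norm ?subr_ge0// (_ : a + (b - a) = b); [lra|ring].
have := @key b (a - b) ab ltac:(lra) ltac:(lra) ltac:(lra).
rewrite distrC ger0_norm ?subr_ge0// (_ : b + (a - b) = a); [lra|ring].
Qed.

End CurveSpeed.

Section Germs.
Variables (R : realType) (O : ominimal R).
Local Notation dfun := (dfun O).

Lemma dfun_C1_near (g : R -> R) (a : R) : dfun g -> exists2 D, dfun D &
  \forall t \near a^'+, C1_at g D t.
Proof.
move=> /(dfun_C1_germ a)[b ab [_ [D [dD hD]]]]; exists D => //.
by apply/near_rightP; exists (b - a) => [|t at_ tb]; [|apply: hD]; lra.
Qed.

(* psi = |y - y(0+)| for the bounded function y = z / (1 + |z|), which is monotone
   near 0 and satisfies |y'| = |z'| / (1 + |z|)^2. *)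
Lemma bounded_variation_germ (z : R -> R) : dfun z ->
  exists psi dpsi dz : R -> R, [/\ dfun psi, dfun dpsi, dfun dz,
    psi t @[t --> (0 : R)^'+] --> (0 : R) &
    \forall t \near (0 : R)^'+, [/\ C1_at z dz t, C1_at psi dpsi t,
      0 <= psi t, 0 <= dpsi t & `|dz t| <= (1 + `|z t|) ^+ 2 * dpsi t]].
Proof.
move=> dz0; pose y t := z t / (1 + `|z t|).
have dy0 : dfun y by rewrite /y; dfn.
have [dz ddz hz] := dfun_C1_near 0 dz0.
have [dy ddy hy] := dfun_C1_near 0 dy0.
have [sg hsg] : exists sg : R, \forall t \near 0^'+, `|z t| = sg * z t.
  have [h|h] : decides 0^'+ (fun t => 0 <= z t) by apply: dpred_right; dfn.
    by exists 1; apply: filterS h => t /ger0_norm ->; rewrite mul1r.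
  by exists (- 1); apply: filterS h => t /negP; rewrite -ltNge => /ltr0_norm ->; rewrite mulN1r.
have [tau tau1 htau] : exists2 tau : R, `|tau| = 1 & \forall t \near 0^'+, tau * dy t = `|dy t|.
  have [h|h] : decides 0^'+ (fun t => 0 <= dy t) by apply: dpred_right; dfn.
    by exists 1; rewrite ?normr1//; apply: filterS h => t /ger0_norm ->; rewrite mul1r.
  exists (- 1); rewrite ?normrN ?normr1//.
  by apply: filterS h => t /negP; rewrite -ltNge => /ltr0_norm ->; rewrite mulN1r.
have [e e0 he] := (near_rightP _ _).1 (filterI (filterI hz hy) (filterI hsg htau)).
have dpsi t : 0 < t -> t < 0 + e -> is_derive t 1 (fun s => tau * y s) (tau * dy t).
  move=> t0 te; have [[_ [hyt _]] _] := he t t0 te; exact: is_deriveZ.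
have ymono s t : 0 < s -> s < t -> t < 0 + e -> tau * y s <= tau * y t.
  move=> s0 st te; have [u /andP[su ut] hu] := mvt_open dpsi s0 st te.
  rewrite -subr_ge0 hu mulr_ge0//; last by rewrite subr_ge0 ltW.
  by have [_ [_ ->]] := he u ltac:(lra) ltac:(lra).
have ybnd t : `|tau * y t| <= 1.
  have z1 : 0 < 1 + `|z t| by rewrite ltr_pwDl.
  by rewrite normrM tau1 mul1r /y normrM normfV (gtr0_norm z1) ler_pdivrMr//; lra.
pose S := [set tau * y t | t in `]0, (0 + e)[].
have hS : has_lbound S by exists (- 1) => _ [t _ <-]; have := ybnd t; rewrite ler_norml => /andP[].
have ycvg : tau * y t @[t --> 0^'+] --> inf S.
  apply: nondecreasing_at_right_cvgr => //; first by rewrite bnd_simp; lra.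
  move=> s t; rewrite !in_itv/= => /andP[s0 se] /andP[t0 te].
  by rewrite le_eqVlt => /predU1P[->//|st]; exact: ymono.
exists (fun t => tau * y t - inf S), (fun t => tau * dy t), dz; split; do ?by dfn.
  by rewrite -[X in _ --> X](subrr (inf S)); apply: cvgB => //; exact: cvg_cst.
apply/near_rightP; exists e => // t t0 te.
have [[hzt [hyt cyt]] [hst htt]] := he t t0 te; split=> //.
- split.
    have : is_derive t 1 (fun s => tau * y s - inf S) (tau * dy t - 0).
      by apply: is_deriveB => //; exact: dpsi.
    by rewrite subr0.
  by apply: continuousM => //; exact: cst_continuous.
- by rewrite subr_ge0; apply: ge_inf => //; exists t => //=; rewrite in_itv/= t0.
- by rewrite htt.
- have [hzt1 _] := hzt.
  have z1 : 1 + sg * z t != 0 by rewrite -hst gt_eqF// ltr_pwDl.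
  have hden : is_derive t 1 (fun s => 1 + sg * z s) (sg * dz t).
    have : is_derive t 1 (fun s => 1 + sg * z s) (0 + sg *: dz t).
      by apply: is_deriveD; exact: is_deriveZ.
    by rewrite add0r.
  have : is_derive t 1 (fun s => z s / (1 + sg * z s)) (dz t / (1 + sg * z t) ^+ 2).
    have hinv := @is_deriveV R (fun s => 1 + sg * z s) t _ 1 z1 hden.
    have := is_deriveM hzt1 hinv => hd; apply: is_derive_eq hd _.
    by rewrite /GRing.scale/=; field.
  move=> hd.
  have hdy : is_derive t 1 y (dz t / (1 + sg * z t) ^+ 2).
    apply: near_eq_is_derive hd; near=> s; rewrite /y.
    have [||_ [<- _]//] := he s.
      by near: s; exact: lt_nbhsr.
    by near: s; exact: lt_nbhsl.
  have -> : tau * dy t = `|dz t| / (1 + `|z t|) ^+ 2.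
    have -> : tau * dy t = `|dy t| by [].
    have [_ <-] := hyt; have [_ ->] := hdy.
    by rewrite normrM normfV -hst [X in _ / X]ger0_norm// sqr_ge0.
  rewrite mulrC divfK// expf_neq0// gt_eqF// ltr_pwDl//.
Unshelve. all: by end_near. Qed.

End Germs.

Section Desingularization.
Variables (R : realType) (O : ominimal R) (p : nat).
Variables (D : 'rV[R]_p -> set 'rV[R]_p) (f : 'rV[R]_p -> R).
Hypotheses (Df : conservative_field_for D f).
Hypotheses (df : definable_fun O f) (dD : definable_setfun O D).
Local Notation dfun := (dfun O).

Definition wt (x : 'rV[R]_p) : R := (1 + enorm x) ^+ 2.

Lemma wt_gt0 x : 0 < wt x.
Proof. by rewrite exprn_gt0// ltr_pwDl// enorm_ge0. Qed.

Definition almost_min (t : R) (x v : 'rV[R]_p) := `|f x| = t /\ D x v /\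
  forall x' v', `|f x'| = t -> D x' v' -> wt x * enorm v <= wt x' * enorm v' + t ^+ 2.

Lemma almost_min_exists t : 0 < t -> (exists x, `|f x| = t) ->
  exists x v, almost_min t x v.
Proof.
move=> t0 [x0 fx0].
pose S := [set a | exists x v, [/\ `|f x| = t, D x v & a = wt x * enorm v]].
have Df1 x : D x !=set0 by have [[_ [cD _]] _] := Df; have [] := cD x.
have S0 : S !=set0.
  by have [v Dv] := Df1 x0; exists (wt x0 * enorm v); exists x0, v.
have hS : has_inf S.
  split=> //; exists 0 => _ [x [v [_ _ ->]]].
  by rewrite mulr_ge0 ?enorm_ge0// ltW// wt_gt0.
have [_ [x [v [fx Dv ->]]] hlt] := inf_adherent (exprn_gt0 2 t0) hS.
exists x, v; split=> //; split=> // x' v' fx' Dv'.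
apply: le_trans (ltW hlt) _; rewrite lerD2r; apply: ge_inf; first by case: hS.
by exists x', v'.
Qed.

Lemma almost_min_curve : exists x v : R -> 'rV[R]_p,
  [/\ forall i, dfun (fun t => x t 0 i), forall i, dfun (fun t => v t 0 i) &
      forall t, (exists x v, almost_min t x v) -> almost_min t (x t) (v t)].
Proof.
have [|c [dc cP]] := @dmap_choice R O 1 (p + p)
    (fun t z => almost_min (t 0 0) (lsubmx z) (rsubmx z)).
  by rewrite /almost_min /wt; dfn.
exists (fun t => lsubmx (c (\row__ t))), (fun t => rsubmx (c (\row__ t))); split.
- by move=> i; dfn.
- by move=> i; dfn.
- move=> t [x [v h]]; have := cP (\row__ t); rewrite mxE; apply.
  by exists (row_mx x v); rewrite row_mxKl row_mxKr.
Qed.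

Lemma desingularizing_germ : (\forall t \near (0 : R)^'+, exists x, `|f x| = t) ->
  exists phi dphi : R -> R, [/\ dfun phi, dfun dphi,
    phi t @[t --> (0 : R)^'+] --> (0 : R) &
    \forall t \near (0 : R)^'+, [/\ C1_at phi dphi t, 0 < phi t, 1 <= dphi t &
      forall x v, `|f x| = t -> D x v -> 1 / 8 <= wt x * enorm v * dphi t]].
Proof.
move=> hne; have [x [v [dx dv xvP]]] := almost_min_curve.
have : forall i : 'I_p, exists P : (R -> R) * (R -> R) * (R -> R),
    [/\ dfun P.1.1, dfun P.1.2, dfun P.2, P.1.1 t @[t --> (0 : R)^'+] --> (0 : R) &
    \forall t \near (0 : R)^'+, [/\ C1_at (fun t => x t 0 i) P.2 t, C1_at P.1.1 P.1.2 t,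
      0 <= P.1.1 t, 0 <= P.1.2 t & `|P.2 t| <= (1 + `|x t 0 i|) ^+ 2 * P.1.2 t]].
  move=> i; have [psi [dpsi [dz h]]] := bounded_variation_germ (dx i).
  by exists (psi, dpsi, dz).
move=> /choice[P hP].
pose psi i := (P i).1.1; pose dpsi i := (P i).1.2; pose dz i := (P i).2.
have dpsi1 i : dfun (psi i) by case: (hP i).
have dpsi2 i : dfun (dpsi i) by case: (hP i).
have ddz i : dfun (dz i) by case: (hP i).
pose phi t := t + \sum_i psi i t.
pose dphi t := 1 + \sum_i dpsi i t.
have dphi1 : dfun phi by rewrite /phi; dfn.
have dphi2 : dfun dphi by rewrite /dphi; dfn.
have phi0 : phi t @[t --> (0 : R)^'+] --> (0 : R).
  have : phi t @[t --> (0 : R)^'+] --> 0 + \sum_(i < p) (0 : R).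
    apply: cvgD; first by apply: cvg_at_right_filter; exact: cvg_id.
    by apply: cvg_big => [|i _]; [exact: add_continuous|case: (hP i)].
  by rewrite big1_eq addr0.
have hnear : \forall t \near (0 : R)^'+, forall i : 'I_p,
    [/\ C1_at (fun t => x t 0 i) (dz i) t, C1_at (psi i) (dpsi i) t,
      0 <= psi i t, 0 <= dpsi i t & `|dz i t| <= (1 + `|x t 0 i|) ^+ 2 * dpsi i t].
  by apply: filter_forall => i; case: (hP i).
have hmin : \forall t \near (0 : R)^'+, almost_min t (x t) (v t).
  near=> t; apply/xvP/almost_min_exists; first by near: t; exact: nbhs_right_gt.
  by near: t.
have C1phi t : (forall i, C1_at (psi i) (dpsi i) t) -> C1_at phi dphi t.
  move=> h; split.
    have -> : phi = id + \sum_i psi i.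
      by apply/funext => s; rewrite /phi fctE/= fct_sumE.
    by apply: is_deriveD; apply: is_derive_sum => i; case: (h i).
  apply: cvgD; first exact: cvg_cst.
  by apply: cvg_big => [|i _]; [exact: add_continuous|case: (h i)].
have sumle t : (forall i, 0 <= dpsi i t) -> 1 <= dphi t.
  by move=> h; rewrite /dphi lerDl sumr_ge0.
have dq : dfun (fun t => wt (x t) * enorm (v t) * dphi t).
  rewrite /dfun /wt; dstep; last by dfn.
  apply: dterm_mul; first by (do 3 dstep; first by dfn); apply: dterm_enorm => i; exact: dx.
  by apply: dterm_enorm => i; exact: dv.
have dfx : dfun (fun t => f (x t)).
  by apply: dterm_definable_fun => // i; exact: dx.
have E1 : \forall t \near (0 : R)^'+, 1 / 4 <= wt (x t) * enorm (v t) * dphi t.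
  have [//|h] : decides (0 : R)^'+ (fun t => 1 / 4 <= wt (x t) * enorm (v t) * dphi t).
    by apply: (@dpred_right _ O); apply: dform_le dq; exact: dterm_cst.
  exfalso.
  have [sg sg1 hsg] : exists2 sg : R, `|sg| = 1 & \forall t \near (0 : R)^'+, f (x t) = sg * t.
    have [hs|hs] : decides (0 : R)^'+ (fun t => 0 <= f (x t)).
      by apply: (@dpred_right _ O); apply: dform_le dfx; exact: dterm_cst.
      exists 1; rewrite ?normr1//; near=> t; rewrite mul1r.
      have [+ _] : almost_min t (x t) (v t) by near: t.
      by rewrite ger0_norm//; near: t.
    exists (- 1); rewrite ?normrN ?normr1//; near=> t; rewrite mulN1r.
    have [+ _] : almost_min t (x t) (v t) by near: t.
    have : ~ 0 <= f (x t) by near: t.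
    by move=> /negP; rewrite -ltNge => /ltr0_norm -> ft; lra.
  have [e e0 he] := (near_rightP _ _).1 (filterI (filterI h hsg) (filterI hnear hmin)).
  have [b [b0 be _]] := pick_right (t := 0) (x := e) (y := e) e0 e0.
  have [a [a0 ab _]] := pick_right b0 b0.
  have := @curve_speed R O p D f Df dD x (fun t => \row_i dz i t) v a b (1 / 4)
    ltac:(lra) (ltW ab).
  move=> hc; have : `|f (x b) - f (x a)| <= 2 * (1 / 4) * (b - a).
    apply: hc.
    - move=> i t at_ tb; rewrite mxE; have [_ [hn _]] := he t ltac:(lra) ltac:(lra).
      by have [[]] := hn i.
    - move=> i t at_ tb; have [_ [hn _]] := he t ltac:(lra) ltac:(lra).
      rewrite (_ : (fun s => (\row_j dz j s) 0 i) = dz i); first by have [[]] := hn i.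
      by apply/funext => s; rewrite mxE.
    - move=> t at_ tb; have [[hq _] [hn [_ [Dv _]]]] := he t ltac:(lra) ltac:(lra).
      split=> //; apply: le_trans (dotp_le _ _) _.
      move: hq => /negP; rewrite -ltNge => /ltW; apply: le_trans.
      rewrite -mulrA [enorm _ * _]mulrC mulrA ler_wpM2r ?enorm_ge0//.
      apply: (@le_trans _ _ (wt (x t) * \sum_i dpsi i t)); last first.
        by rewrite ler_wpM2l ?(ltW (wt_gt0 _))// /dphi lerDr.
      rewrite mulr_sumr; apply: ler_sum => i _; rewrite mxE.
      have [_ _ _ d0 hz] := hn i; apply: le_trans hz _; rewrite ler_wpM2r//.
      rewrite /wt lerXn2r ?nnegrE ?addr_ge0 ?enorm_ge0//.
      by rewrite lerD2l coord_le_enorm.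
  have [[_ ->] _] := he a ltac:(lra) ltac:(lra).
  have [[_ ->] _] := he b ltac:(lra) ltac:(lra).
  rewrite -mulrBr normrM sg1 mul1r ger0_norm; lra.
have E2 : \forall t \near (0 : R)^'+, t ^+ 2 * dphi t <= 1 / 8.
  have [//|h] : decides (0 : R)^'+ (fun t => t ^+ 2 * dphi t <= 1 / 8).
    by apply: (@dpred_right _ O); dfn.
  exfalso.
  have hphi1 := (cvgrPdist_le _ _).1 phi0 _ (@ltr01 R).
  have [e e0 he] := (near_rightP _ _).1 (filterI h (filterI hnear (hphi1 _))).
  have e20 : 0 < e / 2 by lra.
  have [t [t0 te t32]] := @pick_right _ 0 (e / 2) (1 / 32) e20 ltac:(lra).
  have C1t u : 0 < u -> u < e -> is_derive u 1 phi (dphi u).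
    move=> u0 ue; have [_ [hn _]] := he u u0 ltac:(lra).
    by have [] := C1phi u (fun i => let: And5 _ h _ _ _ := hn i in h).
  have [u /andP[tu ut2] hu] := @mvt_open _ phi dphi 0 e t (2 * t) C1t t0 ltac:(lra) ltac:(lra).
  have [hu8 _] := he u ltac:(lra) ltac:(lra).
  have [_ [hnt _]] := he t ltac:(lra) ltac:(lra).
  have [_ [_ h2]] := he (2 * t) ltac:(lra) ltac:(lra).
  have pt : 0 <= phi t.
    by rewrite /phi addr_ge0 ?sumr_ge0 ?(ltW t0)// => i _; case: (hnt i).
  move: hu8 => /negP; rewrite -ltNge => hu8.
  move: h2; rewrite sub0r normrN => /(le_trans (ler_norm _)) h2.
  have u1 : 1 <= dphi u.
    by apply: sumle => i; have [_ [hn _]] := he u ltac:(lra) ltac:(lra); case: (hn i).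
  have hu2 : u ^+ 2 <= 4 * t ^+ 2 by nra.
  nra.
exists phi, dphi; split=> //.
near=> t.
have t0 : 0 < t by near: t; exact: nbhs_right_gt.
have hn : forall i : 'I_p, [/\ C1_at (fun t => x t 0 i) (dz i) t, C1_at (psi i) (dpsi i) t,
      0 <= psi i t, 0 <= dpsi i t & `|dz i t| <= (1 + `|x t 0 i|) ^+ 2 * dpsi i t].
  by near: t.
have hd : 1 <= dphi t by apply: sumle => i; case: (hn i).
split=> //.
- by apply: C1phi => i; case: (hn i).
- by rewrite /phi ltr_wpDr// sumr_ge0// => i _; case: (hn i).
- move=> x' v' fx' Dv'.
  have [_ [_ hm]] : almost_min t (x t) (v t) by near: t.
  have := hm x' v' fx' Dv'.
  have h1 : 1 / 4 <= wt (x t) * enorm (v t) * dphi t by near: t.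
  have h2 : t ^+ 2 * dphi t <= 1 / 8 by near: t.
  nra.
Unshelve. all: by end_near. Qed.

End Desingularization.

Section Kurdyka.
Variables (R : realType) (O : ominimal R).
Local Notation dform := (dform O).
Local Notation dfun := (dfun O).
Local Notation dpred := (dpred O).

Lemma dfun_definable_fun_on (I : set R) (g : R -> R) :
  dpred I -> dfun g -> definable_fun_on O I g.
Proof.
move=> dI dg; rewrite /definable_fun_on.
have : dform (fun z : 'rV[R]_(1 + 1) => I (lsubmx z 0 0) /\ rsubmx z 0 0 = g (lsubmx z 0 0)).
  apply: dform_and; last by dfn.
  by apply: (dpred_app dI); dfn.
set A := (X in _ -> definable O X); suff -> : A = [set z : 'rV[R]_(1 + 1) |
  I (lsubmx z 0 0) /\ rsubmx z 0 0 = g (lsubmx z 0 0)] by [].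
apply/seteqP; split; last first.
  move=> z [Iz zg]; exists (lsubmx z 0 0) => //; rewrite -[RHS]hsubmxK; congr row_mx.
    by apply/rowP => j; rewrite mxE (ord1 j).
  by apply/rowP => j; rewrite mxE (ord1 j).
by move=> _ [t It <-] /=; rewrite row_mxKl row_mxKr !mxE.
Qed.

(* chi r is the solution t of phi(t) = c (1 + |r|)^-4, for a constant c <= 1. *)
Lemma definable_rate (phi : R -> R) (b : R) : 0 < b -> dfun phi ->
  (forall t : R, 0 < t -> t < b -> {for t, continuous phi}) ->
  (forall s t, 0 < s -> s < t -> t < b -> phi s < phi t) ->
  (forall t, 0 < t -> t < b -> 0 < phi t) ->
  phi t @[t --> (0 : R)^'+] --> (0 : R) ->
  exists chi, [/\ dfun chi, continuous chi, forall r, 0 < chi r /\ chi r < b &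
    forall r, phi (chi r) * (1 + `|r|) ^+ 4 <= 1].
Proof.
move=> b0 dphi cphi mphi phi_gt0 phi0; pose b1 := b / 2.
have b10 : 0 < b1 by rewrite /b1; lra.
have b1b : b1 < b by rewrite /b1; lra.
pose c := Num.min 1 (phi b1).
have c0 : 0 < c by rewrite /c lt_min ltr01 phi_gt0.
have c1 : c <= 1 by rewrite /c ge_min lexx.
have cb : c <= phi b1 by rewrite /c ge_min lexx orbT.
pose w (r : R) := (1 + `|r|) ^+ 4.
have w1 r : 1 <= w r by rewrite /w exprn_ege1// lerDl.
have w0 r : 0 < w r by apply: lt_le_trans (w1 r).
have [|chi [dchi chiP]] := @dfun_choice R O (fun r t => 0 < t /\ t <= b1 /\ phi t * w r = c).
  by rewrite /w; dfn.
have {}chiP r : 0 < chi r /\ chi r <= b1 /\ phi (chi r) * w r = c.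
  apply: chiP; have y0 : 0 < c / w r by rewrite divr_gt0.
  have := (cvgrPdist_lt _ _).1 phi0 _ y0 => hy.
  have [e e0 he] := (near_rightP _ _).1 (hy _).
  have [t [t0 te tb]] := @pick_right _ 0 e b1 e0 b10.
  have := he t t0 ltac:(lra); rewrite sub0r normrN => /(le_lt_trans (ler_norm _)) ty.
  have [||u] := @IVT R phi t b1 (c / w r) (ltW tb).
  - apply: continuous_in_subspaceT => u /set_mem; rewrite /= in_itv/= => /andP[tu ub].
    by apply: cphi; lra.
  - rewrite ge_min (ltW ty)/= le_max.
    by rewrite (le_trans _ cb) ?orbT// ler_pdivrMr// ler_peMr// ltW.
  rewrite in_itv/= => /andP[tu ub] hu; exists u; split; first by lra.
  by split=> //; rewrite hu divfK// gt_eqF.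
have phichi r : phi (chi r) = c / w r by have [_ [_ <-]] := chiP r; rewrite mulfK// gt_eqF.
have cw : continuous (fun r => c / w r).
  move=> r; apply: cvgM; first exact: cvg_cst.
  apply: cvgV; first by rewrite gt_eqF.
  rewrite /w; under eq_fun do rewrite exprS exprS expr2.
  have ca : 1 + `|s| @[s --> r] --> 1 + `|r|.
    by apply: cvgD; [exact: cvg_cst|exact: norm_continuous].
  rewrite !exprS expr0 mulr1; do !apply: cvgM => //.
exists chi; split=> //.
- move=> r; apply/cvgrPdist_lt => e e0.
  have [chi0 [chib _]] := chiP r.
  have [lo [lo1 lo2 lo3]] := @pick_left _ (chi r) 0 (chi r - e) chi0 ltac:(lra).
  have [hi [hi1 hi2 hi3]] := @pick_right _ (chi r) b (chi r + e) ltac:(lra) ltac:(lra).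
  have h1 : phi lo < c / w r by rewrite -phichi; apply: mphi; lra.
  have h2 : c / w r < phi hi by rewrite -phichi; apply: mphi; lra.
  near=> r'.
  have k1 : phi lo < phi (chi r').
    by rewrite phichi; near: r'; exact: (cvgr_gt _ (cw r) _ h1).
  have k2 : phi (chi r') < phi hi.
    by rewrite phichi; near: r'; exact: (cvgr_lt _ (cw r) _ h2).
  have [chi0' [chib' _]] := chiP r'.
  have l1 : lo < chi r'.
    rewrite ltNge; apply/negP; rewrite le_eqVlt => /predU1P[e1|l1]; first by rewrite e1 ltxx in k1.
    by have := mphi _ _ chi0' l1 ltac:(lra); lra.
  have l2 : chi r' < hi.
    rewrite ltNge; apply/negP; rewrite le_eqVlt => /predU1P[e1|l2]; first by rewrite e1 ltxx in k2.
    by have := mphi _ _ (_ : 0 < hi) l2 ltac:(lra); lra.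
  by rewrite ltr_distlC; apply/andP; split; lra.
- by move=> r; have [h1 [h2 _]] := chiP r; split=> //; lra.
- by move=> r; have [_ [_ ->]] := chiP r.
Unshelve. all: by end_near. Qed.

End Kurdyka.

Lemma dpred_itv (R : realType) (O : ominimal R) (I : interval R) : dpred O [set` I].
Proof.
apply/om_dim1; exists [:: I]; apply/seteqP; split=> x /=; first by move=> ->.
by rewrite orbF.
Qed.

Lemma kurdyka_of_germ (R : realType) (O : ominimal R) (p : nat)
    (D : 'rV[R]_p -> set 'rV[R]_p) (f : 'rV[R]_p -> R) (phi0 dphi0 : R -> R) (b : R) :
  dfun O phi0 -> phi0 t @[t --> (0 : R)^'+] --> (0 : R) -> 0 < b ->
  (forall t, 0 < t -> t < b -> [/\ C1_at phi0 dphi0 t, 0 < phi0 t, 1 <= dphi0 t &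
    forall x v, `|f x| = t -> D x v -> 1 / 8 <= wt x * enorm v * dphi0 t]) ->
  exists (rho : R) (phi chi : R -> R),
    0 < rho /\
    definable_fun_on O `[0, rho[ phi /\
    (forall s t, s \in `[0, rho[ -> t \in `[0, rho[ -> s < t -> phi s < phi t) /\
    (forall t, t \in `[0, rho[ -> 0 <= phi t) /\
    phi 0 = 0 /\
    (forall t, t \in `]0, rho[ -> derivable phi t 1) /\
    {within `]0, rho[, continuous (derive1 phi)} /\
    {within `[0, +oo[, continuous chi} /\
    (forall t, 0 <= t -> 0 < chi t /\ chi t < rho) /\
    definable_fun_on O `[0, +oo[ chi /\
    (forall x : 'rV[R]_p, 0 < `|f x| -> `|f x| <= chi (enorm x) ->
      forall v, D x v -> enorm v * derive1 phi `|f x| >= 1).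
Proof.
move=> dphi0' phi00 b0 H.
have mono s t : 0 < s -> s < t -> t < b -> phi0 s < phi0 t.
  move=> s0 st tb; have [u /andP[su ut] hu] := @mvt_open _ phi0 dphi0 0 b s t
    (fun u u0 ub => let: And4 h _ _ _ := H u u0 ub in h.1) s0 st tb.
  have [_ _ h1 _] := H u ltac:(lra) ltac:(lra).
  by rewrite -subr_gt0 hu mulr_gt0// ?subr_gt0//; lra.
have pos t : 0 < t -> t < b -> 0 < phi0 t by move=> t0 tb; case: (H t t0 tb).
have cont (t : R) : 0 < t -> t < b -> {for t, continuous phi0}.
  by move=> t0 tb; have [[h _] _ _ _] := H t t0 tb; exact: is_derive_continuous h.
have [chi [dchi cchi chib chile]] := definable_rate b0 dphi0' cont mono pos phi00.
pose phi t := if `[<0 < t>] then 16 * Num.sqrt (phi0 t) else 0.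
pose dphi t := 8 * dphi0 t / Num.sqrt (phi0 t).
have dphi' : dfun O phi by rewrite /phi; dfn.
have phid t : 0 < t -> t < b -> is_derive t 1 phi (dphi t).
  move=> t0 tb; have [[h _] p0 _ _] := H t t0 tb.
  have hs := @is_derive1_comp _ Num.sqrt phi0 t _ _ (is_derive1_sqrt p0) h.
  have : is_derive t 1 (fun s => 16 * Num.sqrt (phi0 s)) (16 *: ((2 * Num.sqrt (phi0 t))^-1 * dphi0 t)).
    exact: is_deriveZ.
  move=> hd; apply: (@near_eq_is_derive _ R R (fun s => 16 * Num.sqrt (phi0 s))).
    near=> s; rewrite /phi; case: asboolP => // /negP.
    have -> // : 0 < s by near: s; exact: lt_nbhsr.
  apply: is_derive_eq hd _; rewrite /dphi /GRing.scale/=; field.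
  by rewrite gt_eqF// sqrtr_gt0.
have phi1 t : 0 < t -> t < b -> derive1 phi t = dphi t.
  by move=> t0 tb; rewrite derive1E; have [_ ->] := phid t t0 tb.
have phi_gt0 t : 0 < t -> t < b -> 0 < phi t.
  by move=> t0 tb; rewrite /phi; case: asboolP => // _; rewrite mulr_gt0// sqrtr_gt0 pos.
have phi_0 : phi 0 = 0 by rewrite /phi; case: asboolP => //; rewrite ltxx.
exists b, phi, chi; split=> //; split.
  by apply: dfun_definable_fun_on => //; exact: dpred_itv.
split.
  move=> s t; rewrite !in_itv/= => /andP[s0 sb] /andP[t0 tb] st.
  have [s00|s00] := leP s 0.
    have -> : s = 0 by lra.
    by rewrite phi_0; apply: phi_gt0; lra.
  rewrite /phi; case: asboolP => // _; case: asboolP => [t00|]; last by move=> /negP; rewrite -leNgt; lra.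
  by rewrite ltr_pM2l// ltr_sqrt ?pos//; exact: mono.
split.
  move=> t; rewrite in_itv/= => /andP[t0 tb]; rewrite /phi; case: asboolP => // _.
split=> //; split.
  by move=> t; rewrite in_itv/= => /andP[t0 tb]; have [] := phid t t0 tb.
split.
  apply: continuous_in_subspaceT => t /set_mem; rewrite /= in_itv/= => /andP[t0 tb].
  have [[h ch] p0 _ _] := H t t0 tb.
  have cd : {for t, continuous dphi}.
    rewrite /dphi; apply: continuousM.
      by apply: continuousM => //; exact: cst_continuous.
    apply: continuousV; first by rewrite gt_eqF// sqrtr_gt0.
    by apply: (@continuous_comp _ _ _ phi0 Num.sqrt); [exact: cont|exact: sqrt_continuous].
  rewrite /prop_for /continuous_at phi1//; apply: cvg_trans cd; apply: near_eq_cvg.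
  near=> s; rewrite phi1//; near: s; [exact: lt_nbhsr|exact: lt_nbhsl].
split; first exact: continuous_subspaceT.
split; first by move=> t _; exact: chib.
split; first by apply: dfun_definable_fun_on => //; exact: dpred_itv.
move=> x fx0 fxchi v Dv.
have [chi0 chib'] := chib (enorm x).
have fxb : `|f x| < b by apply: le_lt_trans fxchi _.
have [_ p0 d1 hxv] := H _ fx0 fxb.
rewrite phi1//; have := hxv x v erefl Dv => h8.
have hle : phi0 `|f x| * (wt x) ^+ 2 <= 1.
  apply: le_trans (chile (enorm x)); rewrite (ger0_norm (enorm_ge0 x)).
  have w1 : 0 <= 1 + enorm x by rewrite addr_ge0// enorm_ge0.
  rewrite /wt -exprM ler_wpM2r ?exprn_ge0//.
  move: fxchi; rewrite le_eqVlt => /predU1P[->//|lt1]; exact/ltW/mono.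
have s0 : 0 < Num.sqrt (phi0 `|f x|) by rewrite sqrtr_gt0.
have w0 := wt_gt0 x.
have sle : Num.sqrt (phi0 `|f x|) * wt x <= 1.
  have : (Num.sqrt (phi0 `|f x|) * wt x) ^+ 2 <= 1 by rewrite exprMn sqr_sqrtr// ltW.
  by rewrite leNgt => h; rewrite leNgt; apply: contra h => h; rewrite exprn_egt1.
rewrite /dphi mulrA ler_pdivlMr// mul1r.
have e0 := enorm_ge0 v.
set S := Num.sqrt _ in s0 sle *.
have : S * (wt x * enorm v * dphi0 `|f x| * 8) <= enorm v * dphi0 `|f x| * 8.
  have : 0 <= enorm v * dphi0 `|f x| * 8 by rewrite !mulr_ge0//; lra.
  nra.
have : S * 1 <= S * (wt x * enorm v * dphi0 `|f x| * 8) by rewrite ler_wpM2l ?(ltW s0)//; lra.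
lra.
Unshelve. all: by end_near. Qed.

Theorem theorem6 (R : realType) (O : ominimal R) (p : nat)
  (D : 'rV[R]_p -> set 'rV[R]_p) (f : 'rV[R]_p -> R) :
  conservative_field_for D f ->
  definable_fun O f -> definable_setfun O D ->
  exists (rho : R) (phi chi : R -> R),
    0 < rho /\
    (* phi : [0, rho) -> R_+ definable, strictly increasing, phi 0 = 0 *)
    definable_fun_on O `[0, rho[ phi /\
    (forall s t, s \in `[0, rho[ -> t \in `[0, rho[ -> s < t -> phi s < phi t) /\
    (forall t, t \in `[0, rho[ -> 0 <= phi t) /\
    phi 0 = 0 /\
    (* phi is C^1 on (0, rho) *)
    (forall t, t \in `]0, rho[ -> derivable phi t 1) /\
    {within `]0, rho[, continuous (derive1 phi)} /\
    (* chi : R_+ -> (0, +oo) continuous definable, with values in the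
       domain of phi (see NOTES.md) *)
    {within `[0, +oo[, continuous chi} /\
    (forall t, 0 <= t -> 0 < chi t /\ chi t < rho) /\
    definable_fun_on O `[0, +oo[ chi /\
    (forall x : 'rV[R]_p, 0 < `|f x| -> `|f x| <= chi (enorm x) ->
      forall v, D x v -> enorm v * derive1 phi `|f x| >= 1).

Proof.
move=> Df df dD.
have dne : dpred O (fun t => exists x : 'rV[R]_p, `|f x| = t) by dfn.
have [hne|he] := dpred_right 0 dne.
  have [phi [dphi [dphi1 _ phi0 hphi]]] := desingularizing_germ Df df dD hne.
  have [b b0 hb] := (near_rightP _ _).1 hphi.
  by apply: (kurdyka_of_germ dphi1 phi0 b0) => t t0 tb; apply: hb; rewrite ?add0r.
have [b b0 hb] := (near_rightP _ _).1 he.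
apply: (@kurdyka_of_germ R O p D f (fun t => t) (fun=> 1) b) => //.
- by dfn.
- by apply: cvg_at_right_filter; exact: cvg_id.
move=> t t0 tb; split=> //.
- by split; [exact: is_derive_id|exact: cst_continuous].
- by move=> x v fx; exfalso; apply: (hb t t0); [rewrite add0r|exists x].
Qed.
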